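(* Let $F$ be a free group of finite rank with a fixed basis $A$. For rational subsets given by deterministic automata, the rational subsets distance problem in $F$ is solvable in polynomial time. That is, there is an algorithm which, given two deterministic finite automata over the alphabet $A\cup A^{-1}$ describing nonempty rational subsets $R,S\subseteq F$, finds elements $r\in R$ and $s\in S$ such that $d_A(r,s)=\min\{d_A(r',s')\mid r'\in R,\ s'\in S\}$, in time polynomial in the size of the two automata.
   Context: For $f\in F$, $|f|$ is the length of the reduced word in $A\cup A^{-1}$ representing $f$, and $d_A(f,f')=|f^{-1}f'|$ is the word metric. A rational subset of $F$ given by a finite automaton over $A\cup A^{-1}$ is the set of elements of $F$ represented by the words accepted by the automaton. The automaton is deterministic if it has one initial state, no edges labelled by the empty word, and from each state at most one outgoing edge with each given label. Rational subsets distance problem: given two rational subsets $R$ and $S$ of $G$, find the distance between $R$ and $S$, i.e., find two elements $r\in R$ and $s\in S$ with a shortest distance apart. *)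

(* Defs.v *)
From HB Require Import structures.
From mathcomp Require Import all_boot.

Set Implicit Arguments.
Unset Strict Implicit.
Unset Printing Implicit Defensive.

Import Algebra.

(** * The free group on a finite basis [A] *)

(* [(a, false)] is the letter a and [(a, true)] is the letter a^-1. *)
Definition letter (A : finType) : finType := (A * bool)%type.

Definition linv (A : finType) (x : letter A) : letter A := (x.1, ~~ x.2).

Definition reduced (A : finType) (w : seq (letter A)) : bool :=
  sorted (fun x y => y != linv x) w.

Definition push_letter (A : finType) (x : letter A) (w : seq (letter A)) :=
  if w is y :: w' then if y == linv x then w' else x :: w else [:: x].

Definition reduce (A : finType) (w : seq (letter A)) : seq (letter A) :=
  foldr (@push_letter A) [::] w.

Definition winv (A : finType) (w : seq (letter A)) : seq (letter A) :=
  rev (map (@linv A) w).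

Section Reduction.
Variable A : finType.
Implicit Types (x y : letter A) (u v w : seq (letter A)).

Lemma linvK : involutive (@linv A).
Proof. by case=> a b; rewrite /linv /= negbK. Qed.

Lemma reduced_cons x w :
  reduced (x :: w) = (if w is y :: _ then y != linv x else true) && reduced w.
Proof. by case: w. Qed.

Lemma push_letter_id x w : reduced (x :: w) -> push_letter x w = x :: w.
Proof.
by rewrite reduced_cons; case: w => //= y w /andP[/negPf->].
Qed.

Lemma push_letter_reduced x w : reduced w -> reduced (push_letter x w).
Proof.
case: w => [|y w] // rw; rewrite /push_letter; case: ifP => [_|/negbT n].
  by move: rw; rewrite reduced_cons => /andP[].
by rewrite reduced_cons n.
Qed.

Lemma foldr_push_reduced u w :
  reduced w -> reduced (foldr (@push_letter A) w u).
Proof. by elim: u => //= x u IHu rw; apply/push_letter_reduced/IHu. Qed.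

Lemma reduce_reduced w : reduced (reduce w).
Proof. exact: foldr_push_reduced. Qed.

Lemma reduce_id w : reduced w -> reduce w = w.
Proof.
elim: w => // x w IHw rxw; rewrite [LHS]/= -/(reduce w) IHw.
  exact: push_letter_id.
by move: rxw; rewrite reduced_cons => /andP[].
Qed.

Lemma push_letterV x w : reduced w ->
  push_letter x (push_letter (linv x) w) = w.
Proof.
case: w => [|y w] rw /=; first by rewrite eqxx.
rewrite linvK; case: (eqVneq y x) => [yx|_] /=; last by rewrite eqxx.
by rewrite -yx push_letter_id.
Qed.

Lemma foldr_push_reduce u w : reduced w ->
  foldr (@push_letter A) w (reduce u) = foldr (@push_letter A) w u.
Proof.
move=> rw; elim: u => //= x u <-; rewrite -/(reduce u).
case: (reduce u) => [|y v] //=; case: eqP => // ->.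
by rewrite push_letterV // foldr_push_reduced.
Qed.

Lemma reduce_catl u w : reduce (reduce u ++ w) = reduce (u ++ w).
Proof. by rewrite /reduce !foldr_cat foldr_push_reduce ?reduce_reduced. Qed.

Lemma reduce_catr u w : reduce (u ++ reduce w) = reduce (u ++ w).
Proof. by rewrite /reduce !foldr_cat -!/(reduce _) (reduce_id (reduce_reduced w)). Qed.

Lemma winvK : involutive (@winv A).
Proof. by move=> w; rewrite /winv map_rev revK mapK //; apply: linvK. Qed.

Lemma reduce_winvl w : reduce (winv w ++ w) = [::].
Proof.
elim: w => //= x w IHw; rewrite -[RHS]IHw /winv /= rev_cons cat_rcons.
rewrite /reduce !foldr_cat /= -/(reduce w); congr foldr.
by rewrite -{2}[x]linvK push_letterV ?reduce_reduced.
Qed.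

Lemma reduce_winvr w : reduce (w ++ winv w) = [::].
Proof. by rewrite -{1}[w]winvK reduce_winvl. Qed.

End Reduction.

Record free_group (A : finType) : Type :=
  FreeElt { free_word : seq (letter A); _ : reduced free_word }.

HB.instance Definition _ (A : finType) := [isSub for @free_word A].
HB.instance Definition _ (A : finType) := [Choice of free_group A by <:].

Section FreeGroup.
Variable A : finType.
Implicit Types f g h : free_group A.

Definition free_of_word (w : seq (letter A)) : free_group A :=
  FreeElt (reduce_reduced w).

Definition free_one : free_group A := free_of_word [::].
Definition free_inv f : free_group A := free_of_word (winv (free_word f)).
Definition free_mul f g : free_group A :=
  free_of_word (free_word f ++ free_word g).

Lemma free_mulA : associative free_mul.
Proof.
by move=> f g h; apply: val_inj; rewrite /= reduce_catl reduce_catr catA.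
Qed.

Lemma free_mul1 : left_id free_one free_mul.
Proof. by case=> w rw; apply: val_inj; rewrite /= reduce_id. Qed.

Lemma free_mulr1 : right_id free_one free_mul.
Proof. by case=> w rw; apply: val_inj; rewrite /= cats0 reduce_id. Qed.

Lemma free_mulV : left_inverse free_one free_inv free_mul.
Proof.
by case=> w rw; apply: val_inj; rewrite /= reduce_catl reduce_winvl.
Qed.

Lemma free_mulrV : right_inverse free_one free_inv free_mul.
Proof.
by case=> w rw; apply: val_inj; rewrite /= reduce_catr reduce_winvr.
Qed.

HB.instance Definition _ := isGroup.Build (free_group A)
  free_mulA free_mul1 free_mulr1 free_mulV free_mulrV.

End FreeGroup.

Definition free_gen (A : finType) (a : A) : free_group A :=
  @FreeElt A [:: (a, false)] isT.

Definition letter_elt (A : finType) (x : letter A) : free_group A :=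
  if x.2 then ((free_gen x.1)^-1)%g else free_gen x.1.

Definition word_elt (A : finType) (w : seq (letter A)) : free_group A :=
  (\prod_(x <- w) letter_elt x)%g.

Lemma word_eltE (A : finType) (w : seq (letter A)) :
  free_word (word_elt w) = reduce w.
Proof.
elim: w => [|[a b] w IHw]; rewrite /word_elt ?big_nil // big_cons.
rewrite -/(word_elt w) [LHS]/= IHw reduce_catr.
by case: b.
Qed.

Definition free_norm (A : finType) (f : free_group A) : nat :=
  size (free_word f).

Definition word_dist (A : finType) (f g : free_group A) : nat :=
  free_norm (f^-1 * g)%g.

(** * Finite automata over the letters and their inverses *)

(* An edge [(p, None, q)] is labelled by the empty word. *)
Record automaton (A : finType) : Type := Automaton {
  nstates : nat;
  initial : {set 'I_nstates};
  final : {set 'I_nstates};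
  edges : {set 'I_nstates * option (letter A) * 'I_nstates}
}.

Definition automaton_size (A : finType) (M : automaton A) : nat :=
  nstates M + #|edges M|.

Inductive run (A : finType) (M : automaton A) :
  'I_(nstates M) -> seq (letter A) -> 'I_(nstates M) -> Prop :=
| run_nil p : run p [::] p
| run_eps p q r w : (p, None, q) \in edges M -> run q w r -> run p w r
| run_letter p q r x w :
    (p, Some x, q) \in edges M -> run q w r -> run p (x :: w) r.

Definition accepts (A : finType) (M : automaton A) (w : seq (letter A)) : Prop :=
  exists p q, [/\ p \in initial M, q \in final M & run p w q].

Definition rational_subset (A : finType) (M : automaton A)
    (f : free_group A) : Prop :=
  exists2 w, accepts M w & word_elt w = f.

Definition deterministic (A : finType) (M : automaton A) : Prop :=
  [/\ exists p, initial M = [set p],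
      forall p q, (p, None, q) \notin edges M
    & forall p x q q', (p, Some x, q) \in edges M ->
        (p, Some x, q') \in edges M -> q = q'].

(** * The model of computation

  Jones's WHILE language over binary trees (Computability and Complexity from a
  Programming Perspective, MIT Press, 1997).  A program is a finite command, so
  it uses a fixed finite number of registers, each holding a tree.

  Instead of unit cost, evaluating an expression is charged the size of every
  value it computes.  This makes the time at least the number of symbols
  written out without any sharing of subtrees, so running times are polynomially
  related to those of multitape Turing machines. *)

Inductive tree : Type := Leaf | Node of tree & tree.

Fixpoint tree_size (t : tree) : nat :=
  if t is Node t1 t2 then (tree_size t1 + tree_size t2).+1 else 1.

Definition tree_head (t : tree) : tree := if t is Node t1 _ then t1 else Leaf.
Definition tree_tail (t : tree) : tree := if t is Node _ t2 then t2 else Leaf.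

Inductive expr : Type :=
| Reg of nat
| ELeaf
| ENode of expr & expr
| EHead of expr
| ETail of expr.

Definition store : Type := nat -> tree.

Definition update (s : store) (i : nat) (t : tree) : store :=
  fun j => if j == i then t else s j.

Fixpoint eval (s : store) (e : expr) : tree :=
  match e with
  | Reg i => s i
  | ELeaf => Leaf
  | ENode e1 e2 => Node (eval s e1) (eval s e2)
  | EHead e1 => tree_head (eval s e1)
  | ETail e1 => tree_tail (eval s e1)
  end.

Fixpoint eval_cost (s : store) (e : expr) : nat :=
  tree_size (eval s e) +
  match e with
  | Reg _ | ELeaf => 0
  | ENode e1 e2 => eval_cost s e1 + eval_cost s e2
  | EHead e1 | ETail e1 => eval_cost s e1
  end.

Inductive cmd : Type :=
| Skip
| Assign of nat & expr
| Seq of cmd & cmd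
| If of expr & cmd & cmd
| While of expr & cmd.

(* [exec c s s' t]: started in [s], the command [c] halts in [s'] after time
   [t].  A test succeeds when its value is not [Leaf]. *)
Inductive exec : cmd -> store -> store -> nat -> Prop :=
| exec_skip s : exec Skip s s 1
| exec_assign s i e :
    exec (Assign i e) s (update s i (eval s e)) (eval_cost s e).+1
| exec_seq c1 c2 s1 s2 s3 t1 t2 :
    exec c1 s1 s2 t1 -> exec c2 s2 s3 t2 -> exec (Seq c1 c2) s1 s3 (t1 + t2).+1
| exec_if_true e c1 c2 s s' t :
    eval s e <> Leaf -> exec c1 s s' t ->
    exec (If e c1 c2) s s' (eval_cost s e + t).+1
| exec_if_false e c1 c2 s s' t :
    eval s e = Leaf -> exec c2 s s' t ->
    exec (If e c1 c2) s s' (eval_cost s e + t).+1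
| exec_while_false e c s :
    eval s e = Leaf -> exec (While e c) s s (eval_cost s e).+1
| exec_while_true e c s1 s2 s3 t1 t2 :
    eval s1 e <> Leaf -> exec c s1 s2 t1 -> exec (While e c) s2 s3 t2 ->
    exec (While e c) s1 s3 (eval_cost s1 e + t1 + t2).+1.

Lemma exec_det c s s1 s2 t1 t2 :
  exec c s s1 t1 -> exec c s s2 t2 -> s1 = s2 /\ t1 = t2.
Proof.
move=> H; elim: H s2 t2 => {c s s1 t1}
  [s|s i e|c1 c2 a b d p q _ IH1 _ IH2|e c1 c2 a b p ne _ IH
  |e c1 c2 a b p ne _ IH|e c a ne|e c a b d p q ne _ IH1 _ IH2] s2 t2 H;
  inversion H; subst=> //.
- by case: (IH1 _ _ ltac:(eassumption)) => ? ?; subst;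
    case: (IH2 _ _ ltac:(eassumption)) => -> ->.
- by case: (IH _ _ ltac:(eassumption)) => -> ->.
- by case: (IH _ _ ltac:(eassumption)) => -> ->.
- by case: (IH1 _ _ ltac:(eassumption)) => ? ?; subst;
    case: (IH2 _ _ ltac:(eassumption)) => -> ->.
Qed.

(* Register 0 is both the input and the output register. *)
Definition input_store (x : tree) : store := update (fun _ => Leaf) 0 x.

Definition computes (c : cmd) (x y : tree) (t : nat) : Prop :=
  exists2 s, exec c (input_store x) s t & s 0 = y.

(** * Representation of inputs and outputs as trees *)

Definition enc_seq (T : Type) (enc : T -> tree) (s : seq T) : tree :=
  foldr (fun x t => Node (enc x) t) Leaf s.

Definition enc_nat (n : nat) : tree := iter n (Node Leaf) Leaf.

Definition enc_bool (b : bool) : tree := if b then Node Leaf Leaf else Leaf.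

Definition enc_option (T : Type) (enc : T -> tree) (o : option T) : tree :=
  if o is Some x then Node Leaf (enc x) else Leaf.

Definition enc_letter (A : finType) (x : letter A) : tree :=
  Node (enc_nat (enum_rank x.1)) (enc_bool x.2).

Definition enc_free (A : finType) (f : free_group A) : tree :=
  enc_seq (@enc_letter A) (free_word f).

Definition enc_state (n : nat) (p : 'I_n) : tree := enc_nat p.

Definition enc_edge (A : finType) (n : nat)
    (e : 'I_n * option (letter A) * 'I_n) : tree :=
  Node (enc_state e.1.1)
    (Node (enc_option (@enc_letter A) e.1.2) (enc_state e.2)).

Definition enc_automaton (A : finType) (M : automaton A) : tree :=
  Node (enc_nat (nstates M))
    (Node (enc_seq (@enc_state _) (enum (initial M)))
       (Node (enc_seq (@enc_state _) (enum (final M)))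
          (enc_seq (@enc_edge A _) (enum (edges M))))).

(* Main.v *)
(** The automata are first saturated (Benois): whenever some path from [p] to
    [q] reads a word that reduces to the empty word, an edge labelled by the
    empty word is added from [p] to [q].  The pairs [(p, q)] are the least
    reflexive and transitive relation closed under enclosing in two edges with
    inverse labels.  A saturated automaton reads every reduced word of its
    rational subset along some path.

    Two reduced words at distance [d] are [pu] and [pv] with [d = |u| + |v|], so
    the distance is the minimum of [|u| + |v|] over the pairs of states that are
    reached from initial states by a common word [p], [u] and [v] leading from
    them to final states.  Conversely any such [p], [u], [v], reduced or not,
    give elements at distance at most [|u| + |v|].  Both the common words [p],
    read in the product of the saturated automata, and the shortest [u], [v] are
    therefore shortest-path problems, and all the words have polynomial length
    (the words of the original automata that represent the two elements may be
    exponentially long, but they are never computed).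

    Running times are bounded by writing the algorithm as a function between
    encoded types, built from functions closed under composition, case analysis
    and iteration along a list with polynomially bounded accumulator. *)

Require Import Defs.
From mathcomp Require Import all_boot.
From mathcomp Require Import zify.

Set Implicit Arguments.
Unset Strict Implicit.
Unset Printing Implicit Defensive.

(** * Polynomial-time functions between encoded types *)

Class code (T : Type) := encode : T -> tree.

#[export] Instance code_unit : code unit := fun=> Leaf.
#[export] Instance code_nat : code nat := enc_nat.
#[export] Instance code_bool : code bool := enc_bool.
#[export] Instance code_prod T U (cT : code T) (cU : code U) : code (T * U) :=
  fun p => Node (encode p.1) (encode p.2).
#[export] Instance code_seq T (cT : code T) : code (seq T) := enc_seq cT.
#[export] Instance code_option T (cT : code T) : code (option T) :=
  enc_option cT.

Definition csize T {cT : code T} (x : T) : nat := tree_size (encode x).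

Definition pbounded T {cT : code T} (g : T -> nat) : Prop :=
  exists K, forall x, g x <= K * csize x ^ K.

(* The program may use all registers from [n] on, starting from arbitrary
   contents in the registers above [n]. *)
Variant ptime T U {cT : code T} {cU : code U} (f : T -> U) : Prop :=
  PTime of forall n, exists c K, forall s x, s n = encode x ->
    exists s' t, [/\ exec c s s' t, s' n = encode (f x),
      forall j, j < n -> s' j = s j & t <= K * csize x ^ K].

Lemma ptimeP T U {cT : code T} {cU : code U} (f : T -> U) n :
  ptime f -> exists c K, forall s x, s n = encode x ->
    exists s' t, [/\ exec c s s' t, s' n = encode (f x),
      forall j, j < n -> s' j = s j & t <= K * csize x ^ K].
Proof. by case=> /(_ n). Qed.

Lemma tree_size_gt0 t : 0 < tree_size t.
Proof. by case: t. Qed.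

Lemma csize_gt0 T {cT : code T} (x : T) : 0 < csize x.
Proof. exact: tree_size_gt0. Qed.

Lemma csize_pair T U {cT : code T} {cU : code U} (x : T) (y : U) :
  csize (x, y) = (csize x + csize y).+1.
Proof. by []. Qed.

Lemma leq_poly K a b : a <= b -> K * a ^ K <= K * b ^ K.
Proof. by case: K => // K ab; rewrite leq_mul2l leq_exp2r // ab orbT. Qed.

(** * Polynomial bounds in the size of the encoded argument *)

Section PBounded.
Context (T : Type) {cT : code T}.
Implicit Types (g h : T -> nat).

Lemma pbounded_le g h : (forall x, g x <= h x) -> pbounded h -> pbounded g.
Proof. by move=> le_gh [K hK]; exists K => x; apply: leq_trans (hK x). Qed.

Lemma pbounded_const k : pbounded (fun _ : T => k).
Proof.
by exists k => x; apply: leq_pmulr; rewrite expn_gt0 csize_gt0.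
Qed.

Lemma pbounded_csize : pbounded (fun x : T => csize x).
Proof. by exists 1 => x; rewrite mul1n. Qed.

Lemma pbounded_add g h : pbounded g -> pbounded h ->
  pbounded (fun x => g x + h x).
Proof.
move=> [K hK] [J hJ]; exists (K + J) => x; rewrite mulnDl.
by apply: leq_add; [apply: leq_trans (hK x) _|apply: leq_trans (hJ x) _];
  rewrite leq_mul2l leq_pexp2l ?csize_gt0 ?leq_addr ?leq_addl ?orbT.
Qed.

Lemma pbounded_mul g h : pbounded g -> pbounded h ->
  pbounded (fun x => g x * h x).
Proof.
(* A single number serves as coefficient and exponent, so it has to dominate both [K * J] and
   [K + J]. *)
move=> [K hK] [J hJ]; exists (K * J + (K + J)) => x.
apply: leq_trans (leq_mul (hK x) (hJ x)) _.
rewrite mulnACA -expnD leq_mul ?leq_addr // leq_pexp2l ?csize_gt0 //.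
exact: leq_addl.
Qed.

Lemma pbounded_exp g k : pbounded g -> pbounded (fun x => g x ^ k).
Proof.
move=> gP; elim: k => [|k IHk]; first exact: pbounded_const.
by apply: pbounded_le (pbounded_mul gP IHk) => x; rewrite expnS.
Qed.

End PBounded.

Lemma eval_cost_ge s e : tree_size (eval s e) <= eval_cost s e.
Proof. by case: e => *; exact: leq_addr. Qed.

(** Only assignments change registers, and an assignment costs at least the size of the value it
    stores. *)
Lemma exec_size c s s' t i :
  exec c s s' t -> tree_size (s' i) <= tree_size (s i) + t.
Proof.
move=> H; elim: H => {c s s' t}; try by intros; lia.
move=> s j e; rewrite /update; case: eqP => _; last lia.
by have := eval_cost_ge s e; lia.
Qed.

(** The output is written within the running time, which bounds its size. This is what lets
    polynomial bounds survive composition. *)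
Lemma pbounded_ptime T U {cT : code T} {cU : code U} (f : T -> U) :
  ptime f -> pbounded (fun x => csize (f x)).
Proof.
move=> /(ptimeP 0)[c [K cP]].
apply: (@pbounded_le _ _ _ (fun x => csize x + K * csize x ^ K)).
  move=> x; have [s' [t [e r _ b]]] := cP (fun=> encode x) x erefl.
  by have := exec_size 0 e; rewrite r -!/(csize _); lia.
apply: pbounded_add; first exact: pbounded_csize.
by exists K.
Qed.

Ltac pbnd :=
  repeat first [ exact: pbounded_const | exact: pbounded_csize
               | assumption | apply: pbounded_add | apply: pbounded_mul
               | apply: pbounded_exp ].

(** * Elementary programs and their composition *)

Section Primitives.
Context (T U : Type) {cT : code T} {cU : code U}.

(** Such a function changes the type but not the tree, so [Skip] computes it. Coincidences between
    codes of different types are exploited through this lemma. *)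
Lemma ptime_coerce (f : T -> U) :
  (forall x, encode (f x) = encode x) -> ptime f.
Proof.
move=> fE; split=> n; exists Skip, 1 => s x sx; exists s, 1; split=> //.
- exact: exec_skip.
- by rewrite fE.
- by rewrite mul1n expn_gt0 csize_gt0.
Qed.

Lemma ptime_expr (f : T -> U) (g : T -> nat) :
  pbounded g ->
  (forall n, exists e, forall s x, s n = encode x ->
     eval s e = encode (f x) /\ eval_cost s e <= g x) ->
  ptime f.
Proof.
move=> gP eP; split=> n; have [e {}eP] := eP n.
have [K hK] : pbounded (fun x => g x + 1) by pbnd.
exists (Assign n e), K => s x sx; have [fe ge] := eP s x sx.
exists (update s n (eval s e)), (eval_cost s e).+1; split.
- exact: exec_assign.
- by rewrite /update eqxx.
- by move=> j jn; rewrite /update ltn_eqF.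
- by apply: leq_trans (hK x); rewrite addn1.
Qed.

Fixpoint quote_tree (t : tree) : expr :=
  if t is Node a b then ENode (quote_tree a) (quote_tree b) else ELeaf.

Lemma ptime_const (y : U) : ptime (fun _ : T => y).
Proof.
have qE s t : eval s (quote_tree t) = t by elim: t => //= a -> b ->.
pose s0 : store := fun=> Leaf.
apply: (@ptime_expr _ (fun=> eval_cost s0 (quote_tree (encode y)))).
  by pbnd.
move=> n; exists (quote_tree (encode y)) => s x _; rewrite qE; split=> //.
by elim: (encode y) => //= a IHa b IHb; rewrite !qE; lia.
Qed.

Lemma ptime_head (f : T -> U) :
  (forall x, encode (f x) = tree_head (encode x)) -> ptime f.
Proof.
move=> fE; apply: (@ptime_expr _ (fun x => csize x + (csize x + 1))).
  by pbnd.
move=> n; exists (EHead (Reg n)) => s x sx /=; rewrite sx fE; split=> //.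
by rewrite /csize; case: (encode x) => //= *; lia.
Qed.

Lemma ptime_tail (f : T -> U) :
  (forall x, encode (f x) = tree_tail (encode x)) -> ptime f.
Proof.
move=> fE; apply: (@ptime_expr _ (fun x => csize x + (csize x + 1))).
  by pbnd.
move=> n; exists (ETail (Reg n)) => s x sx /=; rewrite sx fE; split=> //.
by rewrite /csize; case: (encode x) => //= *; lia.
Qed.

End Primitives.

Lemma ptime_ext T U {cT : code T} {cU : code U} (f g : T -> U) :
  f =1 g -> ptime f -> ptime g.
Proof.
move=> fg [fP]; split=> n; have [c [K cP]] := fP n; exists c, K => s x sx.
by have [s' [t [? e ? ?]]] := cP s x sx; exists s', t; rewrite -fg.
Qed.

Lemma ptime_id T {cT : code T} : ptime (fun x : T => x).
Proof. exact: ptime_coerce. Qed.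

Lemma ptime_comp T U V {cT : code T} {cU : code U} {cV : code V}
    (g : U -> V) (f : T -> U) :
  ptime g -> ptime f -> ptime (fun x => g (f x)).
Proof.
move=> gP fP; split=> n.
have [cf [Kf cfP]] := ptimeP n fP; have [cg [Kg cgP]] := ptimeP n gP.
have fB := pbounded_ptime fP.
have [K hK] : pbounded (fun x => Kf * csize x ^ Kf + Kg * csize (f x) ^ Kg + 1).
  by pbnd.
exists (Seq cf cg), K => s x sx.
have [s1 [t1 [e1 r1 j1 b1]]] := cfP s x sx.
have [s2 [t2 [e2 r2 j2 b2]]] := cgP s1 _ r1.
exists s2, (t1 + t2).+1; split=> //.
- exact: exec_seq e1 e2.
- by move=> j jn; rewrite j2 ?j1.
- by apply: leq_trans (hK x); lia.
Qed.

(** The argument is first copied to register [m], so that it stays available in register [n] for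
    further computations. *)
Lemma ptime_copy T U {cT : code T} {cU : code U} (f : T -> U) n m :
  ptime f -> n < m -> exists c K, forall s x, s n = encode x ->
    exists s' t, [/\ exec c s s' t, s' m = encode (f x),
      forall j, j < m -> s' j = s j & t <= K * csize x ^ K].
Proof.
move=> fP nm; have [c [K cP]] := ptimeP m fP.
have [J hJ] : pbounded (fun x : T => csize x + K * csize x ^ K + 2) by pbnd.
exists (Seq (Assign m (Reg n)) c), J => s x sx.
have [] := cP (update s m (s n)) x; first by rewrite /update eqxx.
move=> s' [t [e r j b]].
exists s', ((eval_cost s (Reg n)).+1 + t).+1; split=> //.
- by apply: exec_seq e; apply: exec_assign.
- by move=> i im; rewrite j // /update ltn_eqF.
- by apply: leq_trans (hJ x); rewrite /= sx -/(csize x); lia.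
Qed.

(** Phrased through the code of [h x] rather than through pairs, so that it also yields list cells,
    [Some] and letters, whose codes are nodes as well. *)
Lemma ptime_node T U V W {cT : code T} {cU : code U} {cV : code V} {cW : code W}
    (h : T -> W) (f : T -> U) (g : T -> V) :
  (forall x, encode (h x) = Node (encode (f x)) (encode (g x))) ->
  ptime f -> ptime g -> ptime h.
Proof.
move=> hE fP gP; split=> n.
have [cf [Kf cfP]] := ptime_copy fP (ltnSn n).
have [cg [Kg cgP]] := ptime_copy gP (ltnW (ltnSn n.+1)).
have fB := pbounded_ptime fP; have gB := pbounded_ptime gP.
have [K hK] : pbounded (fun x => Kf * csize x ^ Kf + Kg * csize x ^ Kg
    + 2 * csize (f x) + 2 * csize (g x) + 10) by pbnd.
exists (Seq (Seq cf cg) (Assign n (ENode (Reg n.+1) (Reg n.+2)))), K => s x sx.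
have [s1 [t1 [e1 r1 j1 b1]]] := cfP s x sx.
have [|s2 [t2 [e2 r2 j2 b2]]] := cgP s1 x; first by rewrite j1.
set e := ENode _ _.
have eE : eval s2 e = encode (h x) by rewrite hE /= r2 j2 // r1.
exists (update s2 n (eval s2 e)), ((t1 + t2).+1 + (eval_cost s2 e).+1).+1.
split.
- by apply: exec_seq; [apply: exec_seq e1 e2|apply: exec_assign].
- by rewrite /update eqxx.
- move=> j jn; have [? ?] : j < n.+1 /\ j < n.+2 by lia.
  by rewrite /update ltn_eqF // j2 // j1.
- apply: leq_trans (hK x).
  by rewrite /= r2 j2 // r1 -/(csize (f x)) -/(csize (g x)); lia.
Qed.

Lemma ptime_pair T U V {cT : code T} {cU : code U} {cV : code V}
    (f : T -> U) (g : T -> V) :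
  ptime f -> ptime g -> ptime (fun x => (f x, g x)).
Proof. exact: ptime_node. Qed.

Lemma ptime_oapp T U V {cT : code T} {cU : code U} {cV : code V}
    (o : T -> option U) (g : T -> U -> V) (h : T -> V) :
  ptime o -> ptime (fun p : T * U => g p.1 p.2) -> ptime h ->
  ptime (fun x => if o x is Some y then g x y else h x).
Proof.
move=> oP gP hP; split=> n.
have [co [Ko coP]] := ptime_copy oP (ltnSn n).
have [cg [Kg cgP]] := ptimeP n gP.
have [ch [Kh chP]] := ptimeP n hP.
have oB := pbounded_ptime oP.
have [K hK] : pbounded (fun x => Ko * csize x ^ Ko
    + Kg * (csize x + csize (o x) + 1) ^ Kg + Kh * csize x ^ Kh
    + (2 * csize x + 4 * csize (o x) + 10)).
  by pbnd.
(* The code of [Some y] is [Node Leaf (encode y)]; its tail is the code of [y], so [e] builds the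
   code of [(x, y)]. *)
pose e := ENode (Reg n) (ETail (Reg n.+1)).
exists (Seq co (If (Reg n.+1) (Seq (Assign n e) cg) ch)), K => s x sx.
have [s1 [t1 [e1 r1 j1 b1]]] := coP s x sx.
have s1x : s1 n = encode x by rewrite j1.
have {hK} := hK x; move: r1; rewrite {2 3}/csize.
case: (o x) => [y|] r1 hK; last first.
  have [s2 [t2 [e2 r2 j2 b2]]] := chP s1 x s1x.
  exists s2, (t1 + (eval_cost s1 (Reg n.+1) + t2).+1).+1; split=> //.
  - by apply: exec_seq e1 _; apply: exec_if_false.
  - by move=> j jn; rewrite j2 // j1 //; lia.
  - by apply: leq_trans hK; rewrite /= r1 /=; lia.
have [|s2 [t2 [e2 r2 j2 b2]]] := cgP (update s1 n (eval s1 e)) (x, y).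
  by rewrite /update eqxx /= s1x r1.
exists s2,
  (t1 + (eval_cost s1 (Reg n.+1) + ((eval_cost s1 e).+1 + t2).+1).+1).+1.
split=> //.
- apply: exec_seq e1 _; apply: exec_if_true; first by rewrite /= r1.
  by apply: exec_seq e2; apply: exec_assign.
- by move=> j jn; rewrite j2 // /update ltn_eqF // j1 //; lia.
- apply: leq_trans hK; rewrite /= r1 s1x /= -/(csize x).
  have yE : csize (Some y) = (1 + csize y).+1 by [].
  have {}b2 : t2 <= Kg * (csize x + csize (Some y) + 1) ^ Kg.
    by apply: leq_trans b2 (leq_poly _ _); rewrite csize_pair yE; lia.
  have yE' : tree_size (cU y) = csize y by [].
  by rewrite yE in b2 *; rewrite !yE'; lia.
Qed.

Definition uncons T (l : seq T) : option (T * seq T) :=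
  if l is x :: l' then Some (x, l') else None.

(** The code of a nonempty list is already the code of the pair of its head and tail, so only the
    node of [Some] has to be put on top. *)
Lemma ptime_uncons_id T {cT : code T} : ptime (@uncons T).
Proof.
split=> n.
have [K hK] : pbounded (fun l : seq T => 3 * csize l + 10) by pbnd.
exists (If (Reg n) (Assign n (ENode ELeaf (Reg n))) Skip), K => s l sl.
have {hK} := hK l; case: l sl => [|x l] sl hK.
  exists s; eexists; split; [|by rewrite sl|by []|].
    by apply: exec_if_false; [exact: sl|exact: exec_skip].
  by apply: leq_trans hK; rewrite /= sl /=; lia.
set e := ENode _ _.
exists (update s n (eval s e)); eexists; split.
- by apply: exec_if_true; [rewrite /= sl|exact: exec_assign].
- by rewrite /update eqxx /= sl.
- by move=> j jn; rewrite /update ltn_eqF.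
- by apply: leq_trans hK; rewrite /= sl -/(csize (x :: l)); lia.
Qed.

(** * Iteration along a list *)

Section Foldl.
Context (X A B : Type) {cX : code X} {cA : code A} {cB : code B}.
Variables (f : X -> A -> B -> A) (a0 : X -> A) (l : X -> seq B).

Lemma csize_cons (b : B) (bs : seq B) :
  csize (b :: bs) = (csize b + csize bs).+1.
Proof. by []. Qed.

Lemma csize_suffix (l1 l2 : seq B) : csize l2 <= csize (l1 ++ l2).
Proof.
by elim: l1 => //= b l1 IH; apply: leq_trans IH _; rewrite csize_cons; lia.
Qed.

Lemma size_le_csize (bs : seq B) : size bs <= csize bs.
Proof. by elim: bs => //= b bs; rewrite csize_cons; lia. Qed.

(** A [While] loop keeps the argument, the remaining list and the accumulator in registers [n],
    [n.+1] and [n.+2], and works from [n.+3] on. The bound on all intermediate accumulators is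
    essential: iterating a polynomial-time step can make sizes grow exponentially. *)
Lemma ptime_foldl_bound :
  ptime a0 -> ptime l ->
  ptime (fun p : X * (A * B) => f p.1 p.2.1 p.2.2) ->
  (exists2 g : X -> nat, pbounded g & forall x l1 l2, l x = l1 ++ l2 ->
     csize (foldl (f x) (a0 x) l1) <= g x) ->
  ptime (fun x => foldl (f x) (a0 x) (l x)).
Proof.
move=> aP lP fP [g gP gB]; split=> n.
have lB := pbounded_ptime lP.
have [cl [Kl clP]] := ptime_copy lP (ltnSn n).
have [ca [Ka caP]] := ptime_copy aP (ltnW (ltnSn n.+1)).
have [cf [Kf cfP]] := ptimeP n.+3 fP.
pose e := ENode (Reg n) (ENode (Reg n.+2) (EHead (Reg n.+1))).
pose body := Seq (Assign n.+3 e) (Seq cf (Seq (Assign n.+2 (Reg n.+3))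
               (Assign n.+1 (ETail (Reg n.+1))))).
(* [W x] bounds the cost of any one round: the register moves, plus a call of [cf] on an argument
   whose size does not depend on the round. *)
pose (W := fun x => 10 * csize x + 10 * g x + 10 * csize (l x) + 30
            + Kf * (csize x + g x + csize (l x) + 2) ^ Kf).
have [K hK] : pbounded (fun x => Kl * csize x ^ Kl + Ka * csize x ^ Ka
    + (csize (l x) + 1) * W x + g x + 10).
  by rewrite /W; pbnd.
have loopP x l1 l2 s : l x = l1 ++ l2 -> s n = encode x ->
    s n.+1 = encode l2 -> s n.+2 = encode (foldl (f x) (a0 x) l1) ->
    exists s' t, [/\ exec (While (Reg n.+1) body) s s' t,
      s' n.+2 = encode (foldl (f x) (a0 x) (l x)),
      forall j, j < n -> s' j = s j & t <= (size l2 + 1) * W x].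
  elim: l2 l1 s => [|b l2 IH] l1 s lE sx sl sa.
    exists s; eexists; split; [exact: exec_while_false| |by []|].
      by rewrite sa lE cats0.
    by rewrite /= sl /W /=; lia.
  set a := foldl _ _ _ in sa.
  have aB : csize a <= g x := gB _ _ _ lE.
  have lB1 : csize (b :: l2) <= csize (l x) by rewrite lE csize_suffix.
  pose s1 := update s n.+3 (eval s e).
  have [|s2 [t2 [e2 r2 j2 b2]]] := cfP s1 (x, (a, b)).
    by rewrite /s1 /update eqxx /= sx sa sl.
  pose s3 := update s2 n.+2 (s2 n.+3).
  pose s4 := update s3 n.+1 (tree_tail (s3 n.+1)).
  have s2l : s2 n.+1 = encode (b :: l2).
    by rewrite j2 1?ltnW // /s1 /update ltn_eqF // ltnW.
  have s3l : s3 n.+1 = encode (b :: l2).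
    by rewrite /s3 /update ltn_eqF.
  have {}IH := IH (rcons l1 b) s4; case: IH.
  - by rewrite lE cat_rcons.
  - rewrite /s4 /s3 /s1 /update !ltn_eqF //; try lia.
    by rewrite j2 ?/s1 /update ?ltn_eqF //; lia.
  - by rewrite /s4 /update eqxx s3l.
  - rewrite /s4 /s3 /update gtn_eqF // eqxx r2 /=.
    by rewrite foldl_rcons.
  move=> s5 [t5 [e5 r5 j5 b5]].
  exists s5; eexists; split.
  - apply: exec_while_true e5; first by rewrite /= sl.
    apply: exec_seq; first exact: exec_assign.
    apply: exec_seq; first exact: e2.
    by apply: exec_seq; apply: exec_assign.
  - by rewrite r5.
  - move=> j jn; rewrite j5 // /s4 /s3 /update !ltn_eqF; try lia.
    by rewrite j2 ?/s1 /update ?ltn_eqF //; lia.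
  - have fB : t2 <= Kf * (csize x + g x + csize (l x) + 2) ^ Kf.
      apply: leq_trans b2 (leq_poly _ _); rewrite !csize_pair.
      by rewrite csize_cons in lB1; lia.
    have r2B : csize (f x a b) <= g x.
      have := gB x (rcons l1 b) l2; rewrite foldl_rcons; apply.
      by rewrite lE cat_rcons.
    have s2B : tree_size (s2 n.+3) <= g x by rewrite r2.
    have bE : tree_size (s n.+1) = (csize b + csize l2).+1 by rewrite sl.
    have bE3 : tree_size (tree_tail (encode (b :: l2))) = csize l2 by [].
    have bE4 : tree_size (encode (b :: l2)) = (csize b + csize l2).+1 by [].
    have bE5 : tree_size (tree_head (s n.+1)) = csize b by rewrite sl.
    rewrite csize_cons in lB1.
    have -> : (size (b :: l2) + 1) * W x = (size l2 + 1) * W x + W x.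
      by rewrite /= addSn mulSn addnC.
    rewrite /= -/s3 s3l bE3 bE4 bE5 bE sx sa -/(csize x) -/(csize a).
    by move: b5 r2B s2B fB aB lB1; rewrite /W; lia.
exists (Seq cl (Seq ca (Seq (While (Reg n.+1) body)
         (Assign n (Reg n.+2))))), K => s x sx.
have [s1 [t1 [e1 r1 j1 b1]]] := clP s x sx.
have [|s2 [t2 [e2 r2 j2 b2]]] := caP s1 x; first by rewrite j1.
case: (loopP x [::] (l x) s2) => //.
- by rewrite j2 ?j1 //; lia.
- by rewrite j2.
move=> s3 [t3 [e3 r3 j3 b3]].
exists (update s3 n (s3 n.+2)); eexists; split.
- apply: exec_seq e1 _; apply: exec_seq e2 _; apply: exec_seq e3 _.
  exact: exec_assign.
- by rewrite /update eqxx.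
- by move=> j jn; rewrite /update ltn_eqF // j3 // j2 ?j1 //; lia.
- apply: leq_trans (hK x); rewrite /= r3.
  have: csize (foldl (f x) (a0 x) (l x)) <= g x.
    by apply: (gB _ _ [::]); rewrite cats0.
  have: (size (l x) + 1) * W x <= (csize (l x) + 1) * W x.
    by rewrite leq_mul2r leq_add2r size_le_csize orbT.
  by rewrite -/(csize (foldl _ _ _)); lia.
Qed.

(** When the growth per round does not depend on the accumulator, the accumulator stays below its
    initial size plus the number of rounds times the largest growth. *)
Lemma ptime_foldl :
  ptime a0 -> ptime l ->
  ptime (fun p : X * (A * B) => f p.1 p.2.1 p.2.2) ->
  (exists2 g : X * B -> nat, pbounded g & forall x a b,
     csize (f x a b) <= csize a + g (x, b)) ->
  ptime (fun x => foldl (f x) (a0 x) (l x)).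
Proof.
move=> aP lP fP [g [K gK] gB]; apply: ptime_foldl_bound => //.
have lB := pbounded_ptime lP; have aB := pbounded_ptime aP.
exists (fun x => csize (a0 x)
          + csize (l x) * (K * (csize x + csize (l x) + 1) ^ K)); first by pbnd.
move=> x l1.
have H l2 : l x = l1 ++ l2 -> csize (foldl (f x) (a0 x) l1) <= csize (a0 x)
    + size l1 * (K * (csize x + csize (l x) + 1) ^ K).
  elim/last_ind: l1 l2 => [|l1 b IH] l2 lE /=; first lia.
  rewrite foldl_rcons; apply: leq_trans (gB _ _ _) _.
  rewrite cat_rcons in lE; have := IH _ lE.
  rewrite size_rcons mulSn; have := gK (x, b).
  have : K * csize (x, b) ^ K <= K * (csize x + csize (l x) + 1) ^ K.
    apply: leq_poly; rewrite csize_pair.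
    have := csize_suffix l1 (b :: l2); rewrite -lE csize_cons; lia.
  lia.
move=> l2 lE; apply: leq_trans (H _ lE) _.
rewrite leq_add2l leq_mul2r (leq_trans _ (size_le_csize _)) ?orbT //.
by rewrite lE size_cat leq_addr.
Qed.

End Foldl.

Section Compositional.
Context (X A B : Type) {cX : code X} {cA : code A} {cB : code B}.

Lemma ptime_fst_id : ptime (@fst A B).
Proof. exact: ptime_head. Qed.

Lemma ptime_snd_id : ptime (@snd A B).
Proof. exact: ptime_tail. Qed.

Lemma ptime_fst (f : X -> A * B) : ptime f -> ptime (fun x => (f x).1).
Proof. by apply: ptime_comp; apply: ptime_head. Qed.

Lemma ptime_snd (f : X -> A * B) : ptime f -> ptime (fun x => (f x).2).
Proof. by apply: ptime_comp; apply: ptime_tail. Qed.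

Lemma ptime_cons (f : X -> A) (g : X -> seq A) :
  ptime f -> ptime g -> ptime (fun x => f x :: g x).
Proof. exact: ptime_node. Qed.

Lemma ptime_Some (f : X -> A) : ptime f -> ptime (fun x => Some (f x)).
Proof. by apply: (ptime_node _ (ptime_const tt)). Qed.

Lemma ptime_predn (f : X -> nat) : ptime f -> ptime (fun x => (f x).-1).
Proof. by apply: ptime_comp; apply: ptime_tail; case. Qed.

Lemma ptime_if (b : X -> bool) (f g : X -> A) :
  ptime b -> ptime f -> ptime g -> ptime (fun x => if b x then f x else g x).
Proof.
move=> bP fP gP.
(* [true] and [Some tt] have the same code, and so have [false] and [None]; branching on a boolean
   thus reduces to branching on an option. *)
pose o x := if b x then Some tt else None.
have oP : ptime o.
  apply: (@ptime_comp _ _ _ _ _ _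
    (fun b : bool => if b then Some tt else None)).
    by apply: ptime_coerce; case.
  by [].
apply: (@ptime_ext _ _ _ _ (fun x => if o x is Some _ then f x else g x)).
  by rewrite /o => x; case: (b x).
apply: (ptime_oapp (g := fun x _ => f x)) oP _ gP.
exact/(ptime_comp fP)/ptime_head.
Qed.

Lemma ptime_uncons (l : X -> seq A) : ptime l -> ptime (fun x => uncons (l x)).
Proof. exact/ptime_comp/ptime_uncons_id. Qed.

End Compositional.

(** * Booleans, lists, unary numbers and equality tests *)

Section Booleans.
Context (X : Type) {cX : code X}.
Implicit Types a b : X -> bool.

Lemma ptime_negb a : ptime a -> ptime (fun x => ~~ a x).
Proof.
move=> aP; apply: (@ptime_ext _ _ _ _ (fun x => if a x then false else true)).
  by move=> x; case: (a x).
exact: ptime_if (ptime_const _) (ptime_const _).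
Qed.

Lemma ptime_andb a b : ptime a -> ptime b -> ptime (fun x => a x && b x).
Proof. by move=> aP bP; exact: ptime_if bP (ptime_const _). Qed.

Lemma ptime_isSome A {cA : code A} (o : X -> option A) :
  ptime o -> ptime (fun x => isSome (o x)).
Proof.
move=> oP.
apply: (@ptime_ext _ _ _ _ (fun x => if o x is Some _ then true else false)).
  by move=> x; case: (o x).
exact: (ptime_oapp (g := fun _ _ => true)) oP (ptime_const _) (ptime_const _).
Qed.

End Booleans.

Section Sequences.
Context (X A B : Type) {cX : code X} {cA : code A} {cB : code B}.

Lemma ptime_catrev (l1 l2 : X -> seq A) :
  ptime l1 -> ptime l2 -> ptime (fun x => catrev (l1 x) (l2 x)).
Proof.
move=> P1 P2.
apply: (@ptime_ext _ _ _ _ (fun x => foldl (fun l a => a :: l) (l2 x) (l1 x))).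
  by move=> x; elim: (l1 x) (l2 x) => //= a l IH l'; rewrite IH.
apply: (ptime_foldl (f := fun _ l a => a :: l)) => //.
  by apply: ptime_cons; do 2?apply: ptime_snd; last apply: ptime_fst;
     [|apply: ptime_snd]; apply: ptime_id.
exists (fun p => csize p); first exact: pbounded_csize.
by move=> x a b; rewrite csize_cons csize_pair; lia.
Qed.

End Sequences.

(* [pt_base] is a hook, redefined as more closure lemmas become available. *)
Ltac pt_base := fail.
Ltac pt :=
  cbn beta;
  repeat (first
    [ assumption | simple eapply ptime_id | simple eapply ptime_const | pt_base
    | simple eapply ptime_fst_id | simple eapply ptime_snd_id
    | simple eapply ptime_fst | simple eapply ptime_snd
    | simple eapply ptime_pair | simple eapply ptime_cons
    | simple eapply ptime_Some | simple eapply ptime_predn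
    | simple eapply ptime_uncons
    | simple eapply ptime_negb | simple eapply ptime_andb
    | simple eapply ptime_isSome | simple eapply ptime_if
    | simple eapply ptime_catrev ]; cbn beta).

Section Concatenation.
Context (X A : Type) {cX : code X} {cA : code A}.
Implicit Types (l : X -> seq A).

Lemma ptime_rev l : ptime l -> ptime (fun x => rev (l x)).
Proof. by rewrite /rev => lP; pt. Qed.

Lemma ptime_cat l1 l2 : ptime l1 -> ptime l2 -> ptime (fun x => l1 x ++ l2 x).
Proof.
move=> P1 P2; have Pr := ptime_rev P1.
apply: (@ptime_ext _ _ _ _ (fun x => catrev (rev (l1 x)) (l2 x))); last by pt.
by move=> x; rewrite catrevE revK.
Qed.

Lemma csize_catrev (l l' : seq A) :
  csize (catrev l l') + 1 = csize l + csize l'.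
Proof.
elim: l l' => [|a l IH] l'; first exact: addnC.
by rewrite /= IH !csize_cons; lia.
Qed.

End Concatenation.

(** Accumulating the blocks in reverse makes each round one [catrev], which grows the accumulator by
    at most the size of the new block. Maps, filters, partial maps and lists of pairs are all
    derived from this case. *)
Lemma ptime_flatten_map X A B {cX : code X} {cA : code A} {cB : code B}
    (l : X -> seq A) (f : X -> A -> seq B) :
  ptime l -> ptime (fun p : X * A => f p.1 p.2) ->
  ptime (fun x => flatten [seq f x y | y <- l x]).
Proof.
move=> lP fP.
apply: (@ptime_ext _ _ _ _
  (fun x => rev (foldl (fun r y => catrev (f x y) r) [::] (l x)))).
  move=> x; set g := fun r y => _.
  suff H r s : rev (foldl g r s) = rev r ++ flatten (map (f x) s) by rewrite H.
  elim: s r => [|y s IH] r /=; first by rewrite cats0.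
  by rewrite IH /g catrevE rev_cat revK catA.
apply: ptime_rev.
apply: (ptime_foldl (f := fun x r y => catrev (f x y) r)) => //; first by pt.
  apply: ptime_catrev; last by pt.
  by apply: (ptime_comp (f := fun p => (p.1, p.2.2)) fP); pt.
exists (fun p => csize (f p.1 p.2)); first exact: pbounded_ptime fP.
by move=> x r y; have /= := csize_catrev (cA := cB) (f x y) r; lia.
Qed.

Section Comprehensions.
Context (X A B : Type) {cX : code X} {cA : code A} {cB : code B}.
Implicit Types (l : X -> seq A).

Lemma ptime_map l (f : X -> A -> B) :
  ptime l -> ptime (fun p : X * A => f p.1 p.2) ->
  ptime (fun x => [seq f x y | y <- l x]).
Proof.
move=> lP fP.
apply: (@ptime_ext _ _ _ _ (fun x => flatten [seq [:: f x y] | y <- l x])).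
  by move=> x; rewrite flatten_map1.
by apply: ptime_flatten_map => //; pt.
Qed.

Lemma ptime_filter l (a : X -> A -> bool) :
  ptime l -> ptime (fun p : X * A => a p.1 p.2) ->
  ptime (fun x => [seq y <- l x | a x y]).
Proof.
move=> lP aP.
apply: (@ptime_ext _ _ _ _
  (fun x => flatten [seq (if a x y then [:: y] else [::]) | y <- l x])).
  by move=> x; elim: (l x) => //= y s ->; case: (a x y).
by apply: ptime_flatten_map => //; pt.
Qed.

Lemma ptime_pmap l (f : X -> A -> option B) :
  ptime l -> ptime (fun p : X * A => f p.1 p.2) ->
  ptime (fun x => pmap (f x) (l x)).
Proof.
move=> lP fP.
apply: (@ptime_ext _ _ _ _ (fun x =>
  flatten [seq (if f x y is Some z then [:: z] else [::]) | y <- l x])).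
  by move=> x; elim: (l x) => //= y s ->; case: (f x y).
apply: ptime_flatten_map => //.
by apply: (ptime_oapp (g := fun _ z => [:: z])) => //; pt.
Qed.

End Comprehensions.

Lemma ptime_allpairs X A B {cX : code X} {cA : code A} {cB : code B}
    (l : X -> seq A) (l' : X -> seq B) : ptime l -> ptime l' ->
  ptime (fun x => [seq (y, z) | y <- l x, z <- l' x]).
Proof.
move=> lP lP'.
apply: (ptime_flatten_map (f := fun x y => [seq (y, z) | z <- l' x])) => //.
apply: (ptime_map (l := fun p : X * A => l' p.1) (f := fun p z => (p.2, z))).
  by apply: (ptime_comp lP'); pt.
by pt.
Qed.

Lemma ptime_size X A {cX : code X} {cA : code A} (l : X -> seq A) :
  ptime l -> ptime (fun x => size (l x)).
Proof.
move=> lP.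
(* A list over [unit] has the same code as its length in unary. *)
apply: (@ptime_ext _ _ _ _ (fun x => size [seq tt | _ <- l x])).
  by move=> x; rewrite size_map.
apply: (ptime_comp (g := @size unit)); last by apply: ptime_map => //; pt.
by apply: ptime_coerce; elim=> //= u s; rewrite /encode /= => ->; case: u.
Qed.

Lemma csize_nat (n : nat) : csize n = n.*2.+1.
Proof.
elim: n => // n IH; rewrite doubleS -IH.
by rewrite -[csize n.+1]/(1 + csize n).+1.
Qed.

Lemma ptime_subn X {cX : code X} (m n : X -> nat) :
  ptime m -> ptime n -> ptime (fun x => m x - n x).
Proof.
move=> mP nP.
apply: (@ptime_ext _ _ _ _
  (fun x => foldl (fun k (_ : unit) => k.-1) (m x) (nseq (n x) tt))).
  move=> x; elim: (n x) (m x) => [|k IH] j; first by rewrite subn0.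
  by transitivity (j.-1 - k); [exact: IH|lia].
apply: (ptime_foldl (f := fun _ k (_ : unit) => k.-1)) => //; last 2 first.
- by pt.
- exists (fun=> 0); first exact: pbounded_const.
  by move=> x k _; rewrite !csize_nat; lia.
apply: (ptime_comp (g := fun n => nseq n tt) _ nP).
by apply: ptime_coerce; elim=> //= k; rewrite /encode /= => ->.
Qed.

Lemma ptime_leq X {cX : code X} (m n : X -> nat) :
  ptime m -> ptime n -> ptime (fun x => m x <= n x).
Proof.
move=> mP nP; have sP := ptime_subn mP nP.
(* A unary number is zero when its code is [Leaf]; the code of [k.+1] is also that of [Some k], so
   the test is a case analysis on an option. *)
apply: (@ptime_ext _ _ _ _ (fun x => if (if m x - n x is k.+1 then Some k
  else None) is Some _ then false else true)).
  by move=> x; rewrite /leq; case: (m x - n x).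
apply: (ptime_oapp (g := fun _ _ => false)); try by pt.
apply: (ptime_comp (g := fun k => if k is j.+1 then Some j else None) _ sP).
by apply: ptime_coerce; case.
Qed.

Definition ptime_eq (T : eqType) {cT : code T} : Prop :=
  ptime (fun p : T * T => p.1 == p.2).

Lemma ptime_eqop X (T : eqType) {cX : code X} {cT : code T} (f g : X -> T) :
  ptime_eq -> ptime f -> ptime g -> ptime (fun x => f x == g x).
Proof.
by move=> eP fP gP; apply: (ptime_comp (f := fun x => (f x, g x)) eP); pt.
Qed.

Lemma ptime_eq_nat : @ptime_eq nat _.
Proof.
apply: (@ptime_ext _ _ _ _ (fun p => (p.1 <= p.2) && (p.2 <= p.1))).
  by move=> p; rewrite eqn_leq.
by apply: ptime_andb; apply: ptime_leq; pt.
Qed.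

Lemma ptime_eq_bool : @ptime_eq bool _.
Proof.
apply: (@ptime_ext _ _ _ _
  (fun p : bool * bool => if p.1 then p.2 else ~~ p.2)).
  by case=> [[] []].
by pt.
Qed.

Lemma ptime_eq_prod (T U : eqType) {cT : code T} {cU : code U} :
  @ptime_eq T _ -> @ptime_eq U _ -> @ptime_eq (T * U)%type _.
Proof. by move=> TP UP; apply: ptime_andb; apply: ptime_eqop => //; pt. Qed.

Lemma ptime_eq_option (T : eqType) {cT : code T} :
  @ptime_eq T _ -> @ptime_eq (option T) _.
Proof.
move=> TP.
apply: (@ptime_ext _ _ _ _ (fun p : option T * option T =>
  if p.1 is Some x then
    if p.2 is Some y then x == y else false
  else ~~ isSome p.2)).
  by case=> [[x|] [y|]].
apply: (ptime_oapp (g := fun p x => if p.2 is Some y then x == y else false));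
  try by pt.
apply: (ptime_oapp (g := fun q y => q.2 == y)); try by pt.
by apply: ptime_eqop => //; pt.
Qed.

Lemma ptime_has X A {cX : code X} {cA : code A} (l : X -> seq A)
    (a : X -> A -> bool) :
  ptime l -> ptime (fun p : X * A => a p.1 p.2) ->
  ptime (fun x => has (a x) (l x)).
Proof.
move=> lP aP; have fP := ptime_filter lP aP.
apply: (@ptime_ext _ _ _ _ (fun x => isSome (uncons [seq y <- l x | a x y]))).
  by move=> x; elim: (l x) => //= y s IH; case: (a x y).
by pt.
Qed.

Lemma ptime_mem X (T : eqType) {cX : code X} {cT : code T} (f : X -> T)
    (l : X -> seq T) :
  @ptime_eq T _ -> ptime f -> ptime l -> ptime (fun x => f x \in l x).
Proof.
move=> TP fP lP.
apply: (@ptime_ext _ _ _ _ (fun x => has (fun y => f x == y) (l x))).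
  by move=> x; rewrite -has_pred1; apply: eq_has => y; rewrite /= eq_sym.
apply: (ptime_has (a := fun x y => f x == y)) => //.
by apply: ptime_eqop => //; pt; apply: (ptime_comp fP); pt.
Qed.

Definition shortest K T (l : seq (K * seq T)) : option (K * seq T) :=
  foldl (fun o e => if o is Some e' then
    if size e'.2 <= size e.2 then o else Some e else Some e) None l.

Lemma ptime_shortest X K T {cX : code X} {cK : code K} {cT : code T}
    (l : X -> seq (K * seq T)) :
  ptime l -> ptime (fun x => shortest (l x)).
Proof.
move=> lP; apply: (ptime_foldl (f := fun _ o e => if o is Some e' then
    if size e'.2 <= size e.2 then o else Some e else Some e)) => //.
- by pt.
- apply: (ptime_oapp
    (g := fun p e' => if size e'.2 <= size p.2.2.2 then p.2.1 else Some p.2.2));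
    try by pt.
  by apply: ptime_if; [apply: ptime_leq; apply: ptime_size|..]; pt.
exists (fun p => csize p + 2); first by pbnd.
have E (e : K * seq T) : csize (Some e) = (1 + csize e).+1 by [].
move=> x o e; case: o => [e'|]; [case: ifP => _|];
  by rewrite ?E csize_pair; lia.
Qed.

Ltac pt_base ::= first
  [ simple eapply ptime_eq_nat | simple eapply ptime_eq_bool
  | eapply ptime_eq_option | eapply ptime_eq_prod
  | simple eapply ptime_eqop | simple eapply ptime_filter
  | simple eapply ptime_map | simple eapply ptime_allpairs
  | simple eapply ptime_cat | simple eapply ptime_mem ].

(** * Sizes of encoded lists *)

Lemma csize_mem (T : eqType) {cT : code T} (x : T) s :
  x \in s -> csize x < csize s.
Proof.
elim: s => // y s IH; rewrite in_cons csize_cons => /predU1P[->|/IH xs].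
  exact: leq_addr.
by rewrite ltnS (leq_trans (ltnW xs)) ?leq_addl.
Qed.

Lemma csize_seq_le (T : eqType) {cT : code T} (s : seq T) k :
  {in s, forall x, csize x <= k} -> csize s <= 1 + size s * (k + 1).
Proof.
elim: s => // x s IH xs; rewrite csize_cons /= mulSn.
have := xs x (mem_head _ _); have: csize s <= 1 + size s * (k + 1).
  by apply: IH => y ys; apply: xs; rewrite in_cons ys orbT.
lia.
Qed.

Lemma csize_filter (T : Type) {cT : code T} (a : pred T) s :
  csize (filter a s) <= csize s.
Proof. by elim: s => //= x s; case: (a x); rewrite !csize_cons; lia. Qed.

Lemma csize_cat (T : Type) {cT : code T} (l l' : seq T) :
  csize (l ++ l') + 1 = csize l + csize l'.
Proof.
elim: l => [|a l IH]; first exact: addnC.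
by rewrite cat_cons !csize_cons; lia.
Qed.

(** Serves to compare the cost of a path with the cost of the path from which it was obtained by
    deleting loops. *)
Lemma sumn_uniq_sub (T : eqType) (f : T -> nat) (s s' : seq T) :
  uniq s -> {subset s <= s'} -> sumn (map f s) <= sumn (map f s').
Proof.
elim: s s' => // x s IH s' /= /andP[xs us] ss'.
have s'P := perm_to_rem (ss' x (mem_head _ _)).
rewrite (perm_sumn (perm_map f s'P)) /= leq_add2l.
apply: IH => // y ys; have := ss' y; rewrite in_cons ys orbT => /(_ isT).
rewrite (perm_mem s'P) in_cons => /orP[/eqP yx|//].
by rewrite -yx ys in xs.
Qed.

(** * Shortest paths in labelled graphs *)

Section BellmanFord.
Context (K L : eqType) {cK : code K} {cL : code L}.
Notation word := (seq L).
Implicit Types (G : seq (K * (word * K))) (T I : seq (K * word)).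

(** An edge is a triple of source, label and target. The label goes in front of the word, so the
    labels along a path appear in the opposite order. *)
Definition bf_extend G T :=
  [seq (p.2.2.2, p.2.2.1 ++ p.1.2) |
     p <- [seq p <- [seq (t, e) | t <- T, e <- G] | p.1.1 == p.2.1]].

Definition bf_keys G I := [seq t.1 | t <- I] ++ [seq e.2.2 | e <- G].

(** Keeping one shortest word for each listed key holds the length of the table below
    [size (bf_keys G I)]; without this selection it could multiply at every round. *)
Definition bf_step G I T :=
  pmap (fun v => shortest [seq t <- T ++ bf_extend G T | t.1 == v])
    (bf_keys G I).

(** The list folded over is only a counter: there is one round for each edge. *)
Definition bf G I := foldl (fun T _ => bf_step G I T) I G.

Lemma shortest_mem (l : seq (K * word)) t : shortest l = Some t -> t \in l.
Proof.
elim/last_ind: l t => // l e IH t; rewrite /shortest foldl_rcons -/(shortest l).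
rewrite mem_rcons in_cons.
case: (shortest l) IH => [e'|] IH; last by case=> ->; rewrite eqxx.
by case: ifP => _ [<-]; rewrite ?eqxx // (IH e') ?orbT.
Qed.

Lemma shortest_min (l : seq (K * word)) t : t \in l ->
  exists2 t', shortest l = Some t' & size t'.2 <= size t.2.
Proof.
elim/last_ind: l => // l e IH; rewrite mem_rcons in_cons.
rewrite /shortest foldl_rcons -/(shortest l) => /predU1P[->|/IH[t' -> t't]].
  case: (shortest l) => [t'|]; last by exists e.
  by case: ifP => ?; [exists t'|exists e].
case: ifP => e't; first by exists t'.
by exists e => //; apply: leq_trans t't; rewrite ltnW // ltnNge e't.
Qed.

Lemma bf_step_mem G I T t :
  t \in bf_step G I T -> t.1 \in bf_keys G I /\ t \in T ++ bf_extend G T.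
Proof.
rewrite /bf_step mem_pmap => /mapP[v vK] /esym/shortest_mem.
by rewrite mem_filter => /andP[/eqP->].
Qed.

Lemma bf_extendP G T t :
  reflect (exists u e, [/\ u \in T, e \in G, u.1 = e.1 &
             t = (e.2.2, e.2.1 ++ u.2)])
          (t \in bf_extend G T).
Proof.
apply: (iffP mapP) => [[p]|[u [e [uT eG ue ->]]]].
  rewrite mem_filter => /andP[/eqP pe /allpairsP[[u e] /= [uT eG pE]]] ->.
  by exists u, e; split=> //; rewrite ?pE // -[u.1]/((u, e).1.1) -pE pe pE.
exists (u, e) => //; rewrite mem_filter /= ue eqxx.
by apply/allpairsP; exists (u, e).
Qed.

Lemma bf_keys_init G I t : t \in I -> t.1 \in bf_keys G I.
Proof. by move=> tI; rewrite mem_cat map_f. Qed.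

Lemma bf_keys_edge G I e : e \in G -> e.2.2 \in bf_keys G I.
Proof.
by move=> eG; rewrite mem_cat (map_f (fun e : K * (word * K) => e.2.2)) ?orbT.
Qed.

Lemma size_bf_step G I T : size (bf_step G I T) <= size (bf_keys G I).
Proof. by rewrite /bf_step size_pmap count_size. Qed.

Lemma csize_entry (v : K) (w : word) (T : seq (K * word)) :
  (v, w) \in T -> csize v + csize w < csize T.
Proof. by move=> tT; apply: leq_trans (csize_mem tT). Qed.

Lemma csize_labelled (u v : K) (w : word) (G : seq (K * (word * K))) :
  (u, (w, v)) \in G -> csize u + csize w + csize v < csize G.
Proof.
move=> eG; have H : csize (u, (w, v)) < csize G by exact: csize_mem eG.
by move: H; rewrite !csize_pair; lia.
Qed.

(** A round prepends at most one label to a word, so word lengths grow linearly with the number of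
    rounds. This is the accumulator bound for [ptime_foldl_bound]. *)
Lemma bf_size G I l1 l2 : G = l1 ++ l2 ->
  let T := foldl (fun T _ => bf_step G I T) I l1 in
  size T <= size (bf_keys G I) /\
  forall (v : K) (w : word), (v, w) \in T ->
    v \in bf_keys G I /\ csize w <= (size l1).+1 * (csize G + csize I).
Proof.
elim/last_ind: l1 l2 => [|l1 e IH] l2 GE.
  split=> [|v w]; first by rewrite size_cat size_map leq_addr.
  rewrite /= mul1n => tI.
  split; first exact: (bf_keys_init G tI).
  by have := csize_entry tI; lia.
rewrite foldl_rcons; set T := foldl _ _ _ => /=; rewrite cat_rcons in GE.
have [_ TB] := IH _ GE.
split=> [|v w /bf_step_mem[tK tT]]; first exact: size_bf_step.
split=> //; rewrite size_rcons mulSn.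
move: tT; rewrite mem_cat => /orP[/TB[_]|]; first by lia.
case/bf_extendP=> -[u w'] [[u' [lab v']] [/TB[_ uB] eG _ [_ ->]]] /=.
have := csize_cat (cT := cL) lab w'; have := csize_labelled eG.
by lia.
Qed.

Lemma csize_bf_keys G I v :
  v \in bf_keys G I -> csize v <= csize G + csize I.
Proof.
rewrite mem_cat => /orP[/mapP[[u w] tI ->]|/mapP[[a [b c]] eG ->]] /=.
  by have := csize_entry tI; lia.
by have := csize_labelled eG; lia.
Qed.

Lemma ptime_bf X {cX : code X} (G : X -> seq (K * (word * K)))
    (I : X -> seq (K * word)) :
  @ptime_eq K _ -> ptime G -> ptime I -> ptime (fun x : X => bf (G x) (I x)).
Proof.
move=> KP GP IP.
pose GT := seq (K * (word * K)); pose IT := seq (K * word).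
apply: (ptime_comp (f := fun x => (G x, I x)) (g := fun p => bf p.1 p.2));
  last by pt.
apply: (ptime_foldl_bound (f := fun p T _ => bf_step p.1 p.2 T)); try by pt.
  apply: (ptime_pmap
    (l := fun q : (GT * IT) * (IT * (K * (word * K))) => bf_keys q.1.1 q.1.2)
    (f := fun q v => shortest [seq t <- q.2.1 ++ bf_extend q.1.1 q.2.1
                              | t.1 == v])).
    by rewrite /bf_keys; pt.
  by apply: ptime_shortest; rewrite /bf_extend; pt.
pose (S := fun p : GT * IT => csize p.1 + csize p.2).
exists (fun p => 1 + S p * (S p + (S p + 1) * S p + 1 + 1)).
  by rewrite /S; pbnd; apply: pbounded_ptime; pt.
move=> [G1 I1] l1 l2 /= GE; have [] := bf_size I1 GE.
set T := foldl _ _ _ => TK TB.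
have KS : size (bf_keys G1 I1) <= S (G1, I1).
  by rewrite size_cat !size_map /S /= addnC leq_add // size_le_csize.
have GS : size l1 < csize G1 + 1.
  rewrite addn1 ltnS; apply: leq_trans (size_le_csize _).
  by rewrite GE size_cat leq_addr.
apply: (leq_trans (n := 1 + size T *
   (S (G1, I1) + (S (G1, I1) + 1) * S (G1, I1) + 1 + 1))).
  apply: csize_seq_le => -[v w] /TB[/csize_bf_keys vS wS].
  rewrite csize_pair -/(S (G1, I1)).
  have : (size l1).+1 * S (G1, I1) <= (S (G1, I1) + 1) * S (G1, I1).
    rewrite leq_mul2r; apply/orP; right.
    by apply: leq_trans GS _; rewrite leq_add2r leq_addr.
  have SE : csize G1 + csize I1 = S (G1, I1) by [].
  rewrite SE in vS wS => H; apply: leq_ltn_trans (leq_add vS wS) _; lia.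
by rewrite leq_add2l leq_mul2r (leq_trans TK KS) orbT.
Qed.

(** Soundness principle: each entry comes from an entry of [I] by following edges of [G]. *)
Lemma bf_inv G I (P : K -> word -> Prop) :
  (forall v w, (v, w) \in I -> P v w) ->
  (forall u lab v w, (u, (lab, v)) \in G -> P u w -> P v (lab ++ w)) ->
  forall v w, (v, w) \in bf G I -> P v w.
Proof.
move=> PI PG v w.
rewrite /bf; elim/last_ind: {2}G v w => [|l e IH] v w; first exact: PI.
rewrite foldl_rcons => /bf_step_mem[_]; rewrite mem_cat => /orP[/IH //|].
move=> /bf_extendP[[u w'] [[u' [lab v']] [/IH uP eG /= uu' [-> ->]]]].
by rewrite -uu' in eG; apply: PG eG uP.
Qed.

Let adj (e e' : K * (word * K)) := e'.1 == e.2.2.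
Let cost (es : seq (K * (word * K))) := sumn [seq size e.2.1 | e <- es].

Let cost_rcons es e : cost (rcons es e) = cost es + size e.2.1.
Proof. by rewrite /cost map_rcons sumn_rcons. Qed.

Let table G I k := iter k (bf_step G I) I.

Lemma bf_table G I : bf G I = table G I (size G).
Proof.
rewrite /bf /table; elim/last_ind: {2 3}G => // l e IH.
by rewrite foldl_rcons size_rcons IH.
Qed.

Lemma table_keys G I k t : t \in table G I k -> t.1 \in bf_keys G I.
Proof. by case: k => [|k]; [exact: bf_keys_init|case/bf_step_mem]. Qed.

Lemma bf_step_min G I T t : t \in T ++ bf_extend G T -> t.1 \in bf_keys G I ->
  exists t', [/\ t' \in bf_step G I T, t'.1 = t.1 & size t'.2 <= size t.2].
Proof.
move=> tT tK.
have [|t' t'E t't] :=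
  @shortest_min [seq u <- T ++ bf_extend G T | u.1 == t.1] t.
  by rewrite mem_filter eqxx.
have := shortest_mem t'E; rewrite mem_filter => /andP[/eqP tt' _].
exists t'; split=> //; rewrite mem_pmap; apply/mapP; exists t.1 => //.
Qed.

(** Each round lets the old entries compete with the extended ones, so the word kept for a key never
    gets longer. *)
Lemma table_mono G I k j t : t \in table G I k ->
  exists t', [/\ t' \in table G I (j + k), t'.1 = t.1 & size t'.2 <= size t.2].
Proof.
move=> tT; elim: j => [|j [u [uT ut us]]]; first by exists t.
have [||u' [u'T u'u u's]] := @bf_step_min G I (table G I (j + k)) u.
- by rewrite mem_cat uT.
- exact: table_keys uT.
- by exists u'; split; rewrite ?u'u // (leq_trans u's).
Qed.

(** Induction on the path: one round extends the entry for the last but one vertex by the last edge.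
    The fictitious edge [e0] into the start vertex lets paths be handled as lists of consecutive
    edges. *)
Lemma table_path G I u es (e0 := (u.1, ([::], u.1))) :
  u \in I -> path adj e0 es -> {subset es <= G} ->
  exists t, [/\ t \in table G I (size es), t.1 = (last e0 es).2.2
                & size t.2 <= cost es + size u.2].
Proof.
move=> uI; elim/last_ind: es => [|es e IH]; first by exists u.
rewrite rcons_path => /andP[pes /eqP ee] esG.
have eG : e \in G by apply: esG; rewrite mem_rcons mem_head.
case: IH => // [x xes|t [tT te ts]].
  by apply: esG; rewrite mem_rcons in_cons xes orbT.
have [||t' [t'T t't t's]] := @bf_step_min G I (table G I (size es))
                               (e.2.2, e.2.1 ++ t.2).
- rewrite mem_cat; apply/orP; right; apply/bf_extendP.
  by exists t, e; rewrite te.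
- exact: bf_keys_edge.
exists t'; rewrite size_rcons last_rcons; split=> //.
apply: leq_trans t's _; rewrite cost_rcons size_cat addnC addnAC.
by rewrite leq_add2r.
Qed.

(* A shortest path may be taken without repeated edges, so [size G] rounds
   suffice. *)
Lemma bf_path G I u es (e0 := (u.1, ([::], u.1))) :
  u \in I -> path adj e0 es -> {subset es <= G} ->
  exists t, [/\ t \in bf G I, t.1 = (last e0 es).2.2
                & size t.2 <= cost es + size u.2].
Proof.
move=> uI pes esG; case: (shortenP pes) => es' pes' /= /andP[_ ues'] sub.
have es'G : {subset es' <= G} by move=> x /sub/esG.
have [t [tT te ts]] := table_path uI pes' es'G.
have [t' [t'T t't t's]] := table_mono (size G - size es') tT.
exists t'; rewrite bf_table -(subnK (uniq_leq_size ues' es'G)) t't te.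
split=> //; apply: leq_trans t's (leq_trans ts _).
by rewrite leq_add2r sumn_uniq_sub.
Qed.

Lemma bf_init G I v w : (v, w) \in I ->
  exists2 w', (v, w') \in bf G I & size w' <= size w.
Proof.
have nG : {subset [::] <= G} by [].
move=> vI; have [[v' w'] [/= tT v'E ws]] :=
  bf_path (es := [::]) vI isT nG.
by exists w'; rewrite -?v'E.
Qed.

(** The word [w] is spelled by some path from an entry of [I], by [bf_inv]. Appending the edge gives
    a path to [v], and [bf_path] finds an entry at least as short, whatever the number of edges. *)
Lemma bf_closed G I u lab v w :
  (u, (lab, v)) \in G -> (u, w) \in bf G I ->
  exists2 w', (v, w') \in bf G I & size w' <= size lab + size w.
Proof.
move=> eG uT.
have [t [es [tI pes esG eu sw]]] : exists t es,
    [/\ t \in I, path adj (t.1, ([::], t.1)) es, {subset es <= G},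
        (last (t.1, ([::], t.1)) es).2.2 = u & size w = cost es + size t.2].
  move: u w uT {eG}; apply: bf_inv => [u w uI|u l v' w eG].
    by exists (u, w), [::].
  move=> [t [es [tI pes esG eu sw]]]; exists t, (rcons es (u, (l, v'))).
  split=> //.
  - by rewrite rcons_path pes /adj /= eu.
  - by move=> x; rewrite mem_rcons in_cons => /predU1P[->|/esG].
  - by rewrite last_rcons.
  - by rewrite size_cat sw cost_rcons addnC addnAC.
have pes' : path adj (t.1, ([::], t.1)) (rcons es (u, (lab, v))).
  by rewrite rcons_path pes /adj /= eu.
have esG' : {subset rcons es (u, (lab, v)) <= G}.
  by move=> x; rewrite mem_rcons in_cons => /predU1P[->|/esG].
have [[v' w'] [/= vT v'E w's]] := bf_path tI pes' esG'.
rewrite last_rcons /= in v'E; exists w'; first by rewrite -v'E.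
by apply: leq_trans w's _; rewrite cost_rcons sw addnAC addnC.
Qed.

End BellmanFord.

(** * The algorithm *)

Section Algorithm.
Variable A : finType.
Notation word := (seq (letter A)).
Notation edge := (nat * (option (letter A) * nat))%type.

(** With basis elements coded by rank, [enc_letter] is the pair code of a basis element and a
    boolean. *)
#[local] Instance code_basis : code A := fun a => enc_nat (enum_rank a).
#[local] Instance code_letter : code (letter A) := @enc_letter A.

Lemma ptime_eq_basis : @ptime_eq A _.
Proof.
pose rank (a : A) : nat := enum_rank a.
have rP : ptime rank by apply: ptime_coerce.
apply: (@ptime_ext _ _ _ _ (fun p => rank p.1 == rank p.2)).
  by move=> p; apply/eqP/eqP => [/val_inj/enum_rank_inj|->].
by apply: ptime_eqop; [exact: ptime_eq_nat|..]; apply: (ptime_comp rP); pt.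
Qed.

Lemma ptime_eq_letter : @ptime_eq (letter A) _.
Proof. exact: (ptime_eq_prod ptime_eq_basis ptime_eq_bool). Qed.

Lemma ptime_linv_id : ptime (@linv A).
Proof.
apply: (ptime_node (f := fun x : letter A => x.1) (g := fun x => ~~ x.2)) => //.
  exact: ptime_head.
exact/ptime_negb/ptime_tail.
Qed.

Lemma ptime_linv X {cX : code X} (f : X -> letter A) :
  ptime f -> ptime (fun x => linv (f x)).
Proof. exact: ptime_comp ptime_linv_id. Qed.

Lemma ptime_omap_linv X {cX : code X} (f : X -> option (letter A)) :
  ptime f -> ptime (fun x => omap (@linv A) (f x)).
Proof.
move=> fP.
apply: (ptime_oapp (g := fun _ x => Some (linv x))) => //; last by pt.
by apply/ptime_Some/ptime_linv; pt.
Qed.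

Lemma ptime_push_letter :
  ptime (fun p : letter A * word => push_letter p.1 p.2).
Proof.
apply: (@ptime_ext _ _ _ _ (fun p : letter A * word =>
  if uncons p.2 is Some q then
    if q.1 == linv p.1 then q.2 else p.1 :: p.2
  else [:: p.1])).
  by case=> x [].
apply: (ptime_oapp
  (g := fun p q => if q.1 == linv p.1 then q.2 else p.1 :: p.2)); try by pt.
apply: ptime_if; try by pt.
by apply: ptime_eqop; [exact: ptime_eq_letter|..]; try apply: ptime_linv; pt.
Qed.

Lemma csize_push_letter (x : letter A) (w : word) :
  csize (push_letter x w) <= csize w + (csize x + 1).
Proof.
case: w => [|y w] /=; first by rewrite csize_cons; lia.
by case: ifP => _; rewrite !csize_cons; lia.
Qed.

Lemma ptime_reduce X {cX : code X} (w : X -> word) :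
  ptime w -> ptime (fun x => reduce (w x)).
Proof.
move=> wP.
apply: (@ptime_ext _ _ _ _
  (fun x => foldl (fun r y => push_letter y r) [::] (rev (w x)))).
  by move=> x; rewrite foldl_rev.
apply: (ptime_foldl (f := fun _ r y => push_letter y r)).
- by pt.
- exact: ptime_rev.
- by apply: (ptime_comp (f := fun p => (p.2.2, p.2.1)) ptime_push_letter); pt.
exists (fun p => csize p.2 + 1).
  apply: pbounded_add (pbounded_const _); apply: pbounded_ptime; pt.
by move=> x r y; apply: csize_push_letter.
Qed.

(** The four lists are reflexivity, edges with empty label, transitivity, and enclosing a pair [t.2]
    of [Z] between edges [t.1.1] and [t.1.2] with inverse labels. *)
Definition sat_rules (E : seq edge) (V : seq nat) (Z : seq (nat * nat)) :=
  [seq (v, v) | v <- V] ++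
  [seq (e.1, e.2.2) | e <- [seq e <- E | ~~ isSome e.2.1]] ++
  [seq (z.1.1, z.2.2) |
     z <- [seq z <- [seq (x, y) | x <- Z, y <- Z] | z.1.2 == z.2.1]] ++
  [seq (t.1.1.1, t.1.2.2.2) |
     t <- [seq t <- [seq (u, z) | u <- [seq (x, y) | x <- E, y <- E], z <- Z] |
       isSome t.1.1.2.1 &&
       ((t.1.2.2.1 == omap (@linv A) t.1.1.2.1) &&
       ((t.1.1.2.2 == t.2.1) && (t.2.2 == t.1.2.1)))]].

(** Filtering one fixed list of pairs bounds the size of every stage and fixes the order of its
    entries, so that stages can be compared as subsequences. *)
Definition sat_step (E : seq edge) (V : seq nat) (Z : seq (nat * nat)) :=
  [seq d <- [seq (p, q) | p <- V, q <- V] | d \in Z ++ sat_rules E V Z].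

(** The list of all pairs counts the rounds: every round before stabilisation adds a pair. *)
Definition sat (E : seq edge) (V : seq nat) : seq (nat * nat) :=
  foldl (fun Z _ => sat_step E V Z) [::] [seq (p, q) | p <- V, q <- V].

Definition saturate (E : seq edge) (V : seq nat) : seq edge :=
  [seq (z.1, (None, z.2)) | z <- sat E V] ++ E.

Ltac pt_base ::= first
  [ simple eapply ptime_eq_nat | simple eapply ptime_eq_bool
  | eapply ptime_eq_letter | eapply ptime_eq_option | eapply ptime_eq_prod
  | simple eapply ptime_eqop | simple eapply ptime_omap_linv
  | simple eapply ptime_filter | simple eapply ptime_map
  | simple eapply ptime_allpairs
  | simple eapply ptime_cat | simple eapply ptime_mem ].

Lemma ptime_sat_rules X {cX : code X} E V Z :
  ptime E -> ptime V -> ptime Z ->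
  ptime (fun x : X => sat_rules (E x) (V x) (Z x)).
Proof.
move=> EP VP ZP.
apply: (ptime_comp (f := fun x => (E x, (V x, Z x)))
  (g := fun p => sat_rules p.1 p.2.1 p.2.2)); last by pt.
by rewrite /sat_rules; pt.
Qed.

Lemma ptime_sat X {cX : code X} E V :
  ptime E -> ptime V -> ptime (fun x : X => sat (E x) (V x)).
Proof.
move=> EP VP.
apply: (ptime_comp (f := fun x => (E x, V x)) (g := fun p => sat p.1 p.2));
  last by pt.
pose D (p : seq edge * seq nat) := [seq (a, b) | a <- p.2, b <- p.2].
have DP : ptime D by rewrite /D; pt.
apply: (ptime_foldl_bound (f := fun p Z _ => sat_step p.1 p.2 Z)) => //.
- by pt.
- by apply: ptime_filter; pt; apply: ptime_sat_rules; pt.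
exists (fun p => csize (D p)); first exact: pbounded_ptime.
move=> p l1 _ _; elim/last_ind: l1 => [|l1 b _]; first exact: csize_gt0.
by rewrite foldl_rcons; apply: csize_filter.
Qed.

Lemma ptime_saturate X {cX : code X} E V :
  ptime E -> ptime V -> ptime (fun x : X => saturate (E x) (V x)).
Proof.
move=> EP VP; have SP := ptime_sat EP VP.
rewrite /saturate; apply: ptime_cat => //.
by apply: (ptime_map (f := fun x z => (z.1, (None, z.2)))) => //; pt.
Qed.

(** * Product graph, reversed graph and candidate answers *)

Definition label_word (o : option (letter A)) : word :=
  if o is Some x then [:: x] else [::].

(** Empty labels too are matched only with empty labels. One automaton can still move alone, because
    saturation gives every used state an empty loop. *)
Definition product_edges (G H : seq edge) :=
  [seq ((p.1.1, p.2.1), (label_word p.1.2.1, (p.1.2.2, p.2.2.2))) |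
     p <- [seq p <- [seq (e, f) | e <- G, f <- H] | p.1.2.1 == p.2.2.1]].

Definition reverse_edges (G : seq edge) :=
  [seq (e.2.2, (label_word e.2.1, e.1)) | e <- G].

(* Words of [common_prefixes] are written backwards, those of
   [shortest_suffixes] forwards. *)
Definition common_prefixes (G H : seq edge) (I J : seq nat) :=
  bf (product_edges G H)
    [seq (p, [::] : word) | p <- [seq (i, j) | i <- I, j <- J]].

Definition shortest_suffixes (G : seq edge) (F : seq nat) :=
  bf (reverse_edges G) [seq (f, [::] : word) | f <- F].

(** [catrev] undoes the reversal of the common prefix. The last component [u ++ v] is there for its
    length, the quantity that [shortest] minimises. *)
Definition candidates (X : seq ((nat * nat) * word)) (U V : seq (nat * word)) :=
  [seq ((catrev p.1.1.2 p.1.2.2, catrev p.1.1.2 p.2.2), p.1.2.2 ++ p.2.2) |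
     p <- [seq p <- [seq (q, v) | q <- [seq (x, u) | x <- X, u <- U], v <- V] |
       (p.1.1.1.1 == p.1.2.1) && (p.1.1.1.2 == p.2.1)]].

(** Collected from the lists themselves, so that both ends of every edge belong to it, as the
    correctness of saturation requires. *)
Definition used_states (I F : seq nat) (E : seq edge) :=
  I ++ F ++ [seq e.1 | e <- E] ++ [seq e.2.2 | e <- E].

Notation nfa := (nat * (seq nat * (seq nat * seq edge)))%type.

Definition saturated (M : nfa) : seq edge :=
  saturate M.2.2.2 (used_states M.2.1 M.2.2.1 M.2.2.2).

Definition solution_words (M N : nfa) : option ((word * word) * word) :=
  shortest (candidates
    (common_prefixes (saturated M) (saturated N) M.2.1 N.2.1)
    (shortest_suffixes (saturated M) M.2.2.1)
    (shortest_suffixes (saturated N) N.2.2.1)).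

(** The pair of empty words is a default, never reached when both automata recognize something. The
    words found need not be reduced, whence [reduce]. *)
Definition solve (M N : nfa) : word * word :=
  if solution_words M N is Some t then (reduce t.1.1, reduce t.1.2)
  else ([::], [::]).

(** * Running time of the algorithm *)

Lemma ptime_label_word X {cX : code X} (o : X -> option (letter A)) :
  ptime o -> ptime (fun x => label_word (o x)).
Proof.
move=> oP; apply: (ptime_oapp (g := fun _ x => [:: x])) => //; last by pt.
by pt.
Qed.

Lemma ptime_product_edges :
  ptime (fun p : seq edge * seq edge => product_edges p.1 p.2).
Proof. by rewrite /product_edges; pt; apply: ptime_label_word; pt. Qed.

Lemma ptime_reverse_edges : ptime reverse_edges.
Proof. by rewrite /reverse_edges; pt; apply: ptime_label_word; pt. Qed.

Lemma ptime_common_prefixes X {cX : code X} G H I J :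
  ptime G -> ptime H -> ptime I -> ptime J ->
  ptime (fun x : X => common_prefixes (G x) (H x) (I x) (J x)).
Proof.
move=> GP HP IP JP.
apply: (ptime_comp (f := fun x => ((G x, H x), (I x, J x)))
  (g := fun q => common_prefixes q.1.1 q.1.2 q.2.1 q.2.2)); last by pt.
apply: ptime_bf; first by pt.
  by apply: (ptime_comp (f := fun q => q.1) ptime_product_edges); pt.
by pt.
Qed.

Lemma ptime_shortest_suffixes X {cX : code X} G F :
  ptime G -> ptime F ->
  ptime (fun x : X => shortest_suffixes (G x) (F x)).
Proof.
move=> GP FP.
apply: (ptime_comp (f := fun x => (G x, F x))
  (g := fun q => shortest_suffixes q.1 q.2)); last by pt.
apply: ptime_bf; first by pt.
  by apply: (ptime_comp (f := fun q => q.1) ptime_reverse_edges); pt.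
by pt.
Qed.

Lemma ptime_candidates X {cX : code X} T U V :
  ptime T -> ptime U -> ptime V ->
  ptime (fun x : X => candidates (T x) (U x) (V x)).
Proof.
move=> TP UP VP.
apply: (ptime_comp (f := fun x => (T x, (U x, V x)))
  (g := fun q => candidates q.1 q.2.1 q.2.2)); last by pt.
by rewrite /candidates; pt.
Qed.

Lemma ptime_saturated X {cX : code X} M :
  ptime M -> ptime (fun x : X => saturated (M x)).
Proof.
move=> MP; apply: (ptime_comp (g := saturated) _ MP).
by apply: ptime_saturate; rewrite /used_states; pt.
Qed.

Lemma ptime_solve : ptime (fun p : nfa * nfa => solve p.1 p.2).
Proof.
apply: (ptime_oapp (g := fun _ t => (reduce t.1.1, reduce t.1.2))).
- apply/ptime_shortest/ptime_candidates.
  + by apply: ptime_common_prefixes; try apply: ptime_saturated; pt.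
  + by apply: ptime_shortest_suffixes; try apply: ptime_saturated; pt.
  + by apply: ptime_shortest_suffixes; try apply: ptime_saturated; pt.
- by apply: ptime_pair; apply: ptime_reduce; pt.
- by pt.
Qed.

(** * Correctness *)

Inductive reads (E : seq edge) : nat -> word -> nat -> Prop :=
| reads_nil p : reads E p [::] p
| reads_step p o q w r :
    (p, (o, q)) \in E -> reads E q w r -> reads E p (label_word o ++ w) r.

Lemma reads_cat E p u q v r :
  reads E p u q -> reads E q v r -> reads E p (u ++ v) r.
Proof.
elim=> // {p u q} p o q u r' eE _ IH /IH qr.
by rewrite -catA; apply: reads_step eE qr.
Qed.

Lemma reads1 E p o q : (p, (o, q)) \in E -> reads E p (label_word o) q.
Proof.
move=> eE; rewrite -[label_word o]cats0.
exact: reads_step eE (reads_nil _ _).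
Qed.

Lemma reads_split E p u v r : reads E p (u ++ v) r ->
  exists2 q, reads E p u q & reads E q v r.
Proof.
move wE: (u ++ v) => w H; elim: H u wE => {p w r} [p|p o q w r eE qr IH] u wE.
  by case: u wE => //= ->; exists p; constructor.
case: o eE wE => [x|] eE /= wE.
  case: u wE => [|y u] /= wE.
    exists p; first exact: reads_nil.
    by rewrite wE; apply: (reads_step (o := Some x)) eE qr.
  case: wE => -> /IH[q' qu uv]; exists q' => //.
  exact: (reads_step (o := Some x)) eE qu.
have [q' qu uv] := IH _ wE; exists q' => //.
exact: (reads_step (o := None)) eE qu.
Qed.

(** * Soundness and completeness of saturation *)

Section Saturation.
Variables (E : seq edge) (V : seq nat).
Hypothesis E_V : forall p o q, (p, (o, q)) \in E -> p \in V /\ q \in V.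

Let D := [seq (p, q) | p <- V, q <- V].
Let Z := sat E V.
Let G := saturate E V.

Lemma mem_pairs p q : ((p, q) \in D) = (p \in V) && (q \in V).
Proof.
apply/allpairsP/andP => [[[a b] /= [aV bV [-> ->]]]|[pV qV]] //.
by exists (p, q).
Qed.

Lemma sat_rulesP (Y : seq (nat * nat)) p q :
  (p, q) \in sat_rules E V Y ->
  [\/ p = q /\ p \in V,
      (p, (None, q)) \in E,
      exists2 r, (p, r) \in Y & (r, q) \in Y
    | exists x a b, [/\ (p, (Some x, a)) \in E, (a, b) \in Y
                      & (b, (Some (linv x), q)) \in E]].
Proof.
rewrite !mem_cat.
case/or4P=> [/mapP[v vV [-> ->]]|/mapP[[a [o b]]]|/mapP[z]|/mapP[t]].
- by constructor 1.
- by rewrite mem_filter; case: o => //= eE [-> ->]; constructor 2.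
- rewrite mem_filter => /andP[/eqP zz /allpairsP[[[a b] [c d]] /= [aY cY zE]]].
  move: zz; rewrite zE /= => bc [-> ->]; constructor 3.
  by exists b; rewrite // bc.
rewrite mem_filter => /andP[tt /allpairsP[[u z] /= [/allpairsP[]]]].
move=> [[a [o b]] [c [o' d]]] /= [e1 e2 ->]; case: z => [m n] zY tE; subst t.
move: tt => /=; case: o e1 => // x e1 /= /and3P[/eqP o'E /eqP bm /eqP nc].
move=> [-> ->]; constructor 4; exists x, m, n.
by split; rewrite // -?bm // nc -o'E.
Qed.

(** Each rule preserves the existence of such a word: words are concatenated, or enclosed between a
    letter and its inverse. *)
Lemma sat_sound p q : (p, q) \in Z ->
  exists2 w, reads E p w q & reduce w = [::].
Proof.
rewrite /Z /sat; elim/last_ind: [seq _ | _ <- _, _ <- _] p q => // l d IH p q.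
rewrite foldl_rcons mem_filter mem_cat => /andP[/orP[/IH //|/sat_rulesP H] _].
case: H => [[-> _]|eE|[r /IH[u pu u0] /IH[v vq v0]]
  |[x [a [b [e1 /IH[w ab w0] e2]]]]].
- by exists [::] => //; constructor.
- by exists [::] => //; apply: reads1 eE.
- exists (u ++ v); first exact: reads_cat pu vq.
  by rewrite -reduce_catl u0 v0.
exists (x :: w ++ [:: linv x]).
  exact: reads_step e1 (reads_cat ab (reads1 e2)).
rewrite [LHS]/= -/(reduce _) -reduce_catl w0 /= eqxx //.
Qed.

Let stage k := iter k (sat_step E V) [::].

Lemma sat_stage : Z = stage (size D).
Proof.
rewrite /Z /sat /stage -/D; elim/last_ind: D => // l d IH.
by rewrite foldl_rcons size_rcons IH.
Qed.

(** All nonzero stages filter the same list [D], and a pair that passes one filter passes the next,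
    since a step retains the pairs it starts from. Hence the earlier stage is a filter of the later
    one. *)
Lemma stage_subseq k : subseq (stage k) (stage k.+1).
Proof.
case: k => [|k]; first exact: sub0seq.
rewrite [stage k.+1]iterS; set Y := iter _ _ _.
have -> : sat_step E V Y =
    filter (mem (Y ++ sat_rules E V Y)) (stage k.+2).
  rewrite [stage k.+2]/= -/Y /sat_step -/D -filter_predI.
  apply: eq_in_filter => d dD /=; case: (boolP (d \in Y ++ _)) => //= dY.
  by rewrite mem_cat mem_filter dD dY.
exact: filter_subseq.
Qed.

(** Once two consecutive stages agree they agree forever; until then each stage is a proper
    subsequence of the next. At [k = size D] the second alternative is impossible. *)
Lemma stage_grows k : stage k.+1 = stage k \/ k < size (stage k.+1).
Proof.
elim: k => [|k [IH|IH]].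
- by case: (stage 1) => [|d s]; [left|right].
- by left; rewrite [stage k.+2]iterS [RHS]iterS; congr sat_step.
have := size_subseq_leqif (stage_subseq k.+1).
case: eqVneq => [->|_]; first by left.
by move/ltn_leqif => lt; right; apply: leq_ltn_trans IH _; rewrite lt.
Qed.

Lemma sat_fix : sat_step E V Z = Z.
Proof.
rewrite sat_stage; case: (stage_grows (size D)) => //.
by rewrite ltnNge [stage _.+1]iterS size_filter count_size.
Qed.

Lemma sat_subset p q : (p, q) \in Z -> p \in V /\ q \in V.
Proof. by rewrite -sat_fix mem_filter mem_pairs => /andP[_ /andP]. Qed.

Lemma sat_closed p q : p \in V -> q \in V ->
  (p, q) \in sat_rules E V Z -> (p, q) \in Z.
Proof.
by move=> pV qV pq; rewrite -sat_fix mem_filter mem_pairs pV qV mem_cat pq orbT.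
Qed.

Lemma sat_refl p : p \in V -> (p, p) \in Z.
Proof.
by move=> pV; apply: sat_closed => //; rewrite !mem_cat map_f.
Qed.

Lemma sat_edge p q : (p, (None, q)) \in E -> (p, q) \in Z.
Proof.
move=> eE; have [pV qV] := E_V eE; apply: sat_closed => //.
rewrite !mem_cat; apply/or4P; constructor 2.
by apply/mapP; exists (p, (None, q)); rewrite // mem_filter.
Qed.

Lemma sat_trans p q r : (p, q) \in Z -> (q, r) \in Z -> (p, r) \in Z.
Proof.
move=> pq qr; have [pV _] := sat_subset pq; have [_ rV] := sat_subset qr.
apply: sat_closed => //; rewrite !mem_cat; apply/or4P; constructor 3.
apply/mapP; exists ((p, q), (q, r)); rewrite // mem_filter /= eqxx.
by apply/allpairsP; exists ((p, q), (q, r)).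
Qed.

Lemma sat_cancel x p a b q : (p, (Some x, a)) \in E -> (a, b) \in Z ->
  (b, (Some (linv x), q)) \in E -> (p, q) \in Z.
Proof.
move=> e1 ab e2; have [pV _] := E_V e1; have [_ qV] := E_V e2.
apply: sat_closed => //; rewrite !mem_cat; apply/or4P; constructor 4.
apply/mapP; exists (((p, (Some x, a)), (b, (Some (linv x), q))), (a, b)) => //.
rewrite mem_filter /= !eqxx /=; apply/allpairsP.
exists (((p, (Some x, a)), (b, (Some (linv x), q))), (a, b)); split=> //.
by apply/allpairsP; exists ((p, (Some x, a)), (b, (Some (linv x), q))).
Qed.

Lemma mem_saturate p o q :
  ((p, (o, q)) \in G) = ((o == None) && ((p, q) \in Z)) || ((p, (o, q)) \in E).
Proof.
rewrite mem_cat; congr orb; apply/mapP/andP => [[[a b] abZ [-> -> ->]]|].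
  by rewrite eqxx.
by case=> /eqP-> pqZ; exists (p, q).
Qed.

Lemma saturate_refl p : p \in V -> (p, (None, p)) \in G.
Proof. by move=> pV; rewrite mem_saturate sat_refl. Qed.

Lemma saturate_states p o q : (p, (o, q)) \in G -> p \in V /\ q \in V.
Proof. by rewrite mem_saturate => /orP[/andP[_ /sat_subset]|/E_V]. Qed.

Lemma saturate_sound p w q : reads G p w q ->
  exists2 w', reads E p w' q & reduce w' = reduce w.
Proof.
elim=> {p w q} [p|p o q w r]; first by exists [::] => //; constructor.
rewrite mem_saturate.
case/orP=> [/andP[/eqP-> /sat_sound[u pu u0]]|eE] _ [w' qr w'E].
  exists (u ++ w'); first exact: reads_cat pu qr.
  by rewrite -reduce_catl u0.
exists (label_word o ++ w'); first exact: reads_step eE qr.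
by rewrite -reduce_catr w'E reduce_catr.
Qed.

(** By transitivity the empty moves before the first letter merge into one pair of [Z]; reflexivity
    covers the case where there are none. *)
Lemma saturate_letter p y w r : p \in V -> reads G p (y :: w) r ->
  exists a b, [/\ (p, a) \in Z, (a, (Some y, b)) \in E & reads G b w r].
Proof.
move=> pV; move uE: (y :: w) => u H; elim: H uE pV => {p u r} // p o q u r.
case: o => [x|] eG qr IH uE pV.
  case: uE => yx wu; exists p, q; rewrite sat_refl // yx wu.
  by move: eG; rewrite mem_saturate.
have [_ qV] := saturate_states eG.
have [a [b [qa ab br]]] := IH uE qV; exists a, b; split=> //.
apply: sat_trans qa; move: eG; rewrite mem_saturate eqxx.
by case/orP=> // /sat_edge.
Qed.

(** Induction on the run, reducing from the right. If the new letter [x] cancels the first letter of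
    the reduced rest, the edge for [x], a pair of [Z] and the edge for its inverse follow each
    other, and the enclosing rule replaces them by one empty edge. *)
Lemma saturate_complete p w q :
  reads E p w q -> p \in V -> reads G p (reduce w) q.
Proof.
elim=> {p w q} [p|p o q w r eE _ IH] pV; first exact: reads_nil.
have [_ qV] := E_V eE; have {}IH := IH qV.
have eG : (p, (o, q)) \in G by rewrite mem_saturate eE orbT.
case: o eE eG => [x|] eE eG; last exact: (reads_step (o := None)) eG IH.
rewrite [reduce _]/= -/(reduce w).
case: (reduce w) IH => [|y v] IH; first exact: (reads_step (o := Some x)) eG IH.
rewrite /push_letter; case: eqP => [yx|_];
  last exact: (reads_step (o := Some x)) eG IH.
have [a [b [qa ab br]]] := saturate_letter qV IH.
apply: (reads_step (o := None)) br; rewrite mem_saturate eqxx.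
by rewrite (@sat_cancel x p q a b) // -yx.
Qed.

End Saturation.

(** * Common prefixes as paths in the product *)

Section CommonPrefixes.
Variables (G H : seq edge) (I J : seq nat).
Let X := common_prefixes G H I J.

Lemma common_prefixes_sound p q u : ((p, q), u) \in X ->
  exists i j, [/\ i \in I, j \in J, reads G i (rev u) p & reads H j (rev u) q].
Proof.
pose P (v : nat * nat) u := exists i j,
  [/\ i \in I, j \in J, reads G i (rev u) v.1 & reads H j (rev u) v.2].
suff: forall v u, (v, u) \in X -> P v u by move=> H0 /H0.
apply: bf_inv => [v w|v lab v' w].
  case/mapP=> -[i j] /allpairsP[[i' j'] /= [iI jJ [-> ->]]] [-> ->].
  by exists i', j'; split=> //; constructor.
case/mapP=> -[[a [o b]] [c [o' d]]]; rewrite mem_filter /= => /andP[/eqP <-].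
case/allpairsP=> -[e f] /= [eG fH [eE fE]] [-> -> ->] [i [j [iI jJ /= ia jc]]].
(* A label has at most one letter and so equals its own reversal. *)
have rl : rev (label_word o ++ w) = rev w ++ label_word o.
  by case: (o) => [x|]; rewrite ?cats0 // rev_cons cats1.
exists i, j; split; rewrite //= rl.
  by apply: reads_cat ia (reads1 _); rewrite eE.
by apply: reads_cat jc (reads1 _); rewrite fE.
Qed.

Hypothesis G_refl : forall p o q, (p, (o, q)) \in G -> (q, (None, q)) \in G.
Hypothesis H_refl : forall p o q, (p, (o, q)) \in H -> (q, (None, q)) \in H.

Let meet p q := exists u, ((p, q), u) \in X.

Lemma meet_step p q o p' q' : (p, (o, p')) \in G -> (q, (o, q')) \in H ->
  meet p q -> meet p' q'.
Proof.
move=> eG eH [u uX].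
have eGH : ((p, q), (label_word o, (p', q'))) \in product_edges G H.
  apply/mapP; exists ((p, (o, p')), (q, (o, q'))); rewrite // mem_filter eqxx.
  by apply/allpairsP; exists ((p, (o, p')), (q, (o, q'))).
by have [w wX _] := bf_closed eGH uX; exists w.
Qed.

(** The first automaton waits on its empty loop while the second follows empty edges. *)
Lemma meet_nil p q w q' : (p, (None, p)) \in G -> reads H q w q' ->
  w = [::] -> meet p q -> meet p q'.
Proof.
move=> pG; elim=> // {q w q'} q o r w q' eH _ IH; case: o eH => // eH wE pq.
exact/(IH wE)/(meet_step pG eH).
Qed.

Lemma meet_letter p q x w q' : (p, (None, p)) \in G -> reads H q (x :: w) q' ->
  meet p q ->
  exists r s, [/\ meet p r, (r, (Some x, s)) \in H & reads H s w q'].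
Proof.
move=> pG; move vE: (x :: w) => v qq'; elim: qq' vE => // {q v q'}.
move=> q o r v q' eH rq' IH; case: o eH => [y|] eH vE pq.
  by case: vE eH => <- -> eH; exists q, r.
exact/(IH vE)/(meet_step pG eH).
Qed.

(** The two runs are synchronised by induction on the first. At an empty edge the second automaton
    waits on its loop; at a letter it first advances to its own edge with that letter, by
    [meet_letter]. *)
Lemma meet_reads p w p' q q' : reads G p w p' -> reads H q w q' ->
  (p, (None, p)) \in G -> (q, (None, q)) \in H -> meet p q -> meet p' q'.
Proof.
move=> pp'; elim: pp' q => {p w p'} [p|p o r w p' eG _ IH] q qq' pG qH pq.
  exact: meet_nil qq' erefl pq.
case: o eG qq' => [x|] eG qq'; last first.
  exact: IH qq' (G_refl eG) qH (meet_step eG qH pq).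
have [a [b [pa ab bq']]] := meet_letter pG qq' pq.
exact: IH bq' (G_refl eG) (H_refl ab) (meet_step eG ab pa).
Qed.

Lemma common_prefixes_complete i j w p q :
  i \in I -> j \in J -> (i, (None, i)) \in G -> (j, (None, j)) \in H ->
  reads G i w p -> reads H j w q -> exists u, ((p, q), u) \in X.
Proof.
move=> iI jJ iG jH ip jq; apply: meet_reads ip jq iG jH _.
have ijI : ((i, j), [::]) \in
    [seq (p, [::] : word) | p <- [seq (i, j) | i <- I, j <- J]].
  by apply: map_f; apply/allpairsP; exists (i, j).
by have [u uX _] := bf_init (product_edges G H) ijI; exists u.
Qed.

End CommonPrefixes.

(** * Shortest suffixes and candidate answers *)

Lemma shortest_suffixes_sound G F p u : (p, u) \in shortest_suffixes G F ->
  exists2 f, f \in F & reads G p u f.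
Proof.
move: p u; apply: bf_inv => [p u /mapP[f fF [-> ->]]|p lab q u].
  by exists f => //; constructor.
case/mapP=> -[a [o b]] eG [-> -> ->] [f fF bf].
by exists f => //; apply: reads_step eG bf.
Qed.

Lemma shortest_suffixes_min G F p w f : f \in F -> reads G p w f ->
  exists2 u, (p, u) \in shortest_suffixes G F & size u <= size w.
Proof.
move=> fF pf; elim: pf fF => {p w f} [p|p o q w f eG _ IH] fF.
  have pF : (p, [::]) \in [seq (f, [::] : word) | f <- F] by apply: map_f.
  by have [u uT us] := bf_init (reverse_edges G) pF; exists u.
have [u uT us] := IH fF.
have eR : (q, (label_word o, p)) \in reverse_edges G.
  by apply/mapP; exists (p, (o, q)).
have [v vT vs] := bf_closed eR uT; exists v => //.
by rewrite size_cat (leq_trans vs) ?leq_add2l.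
Qed.

Lemma candidates_sound X U V t : t \in candidates X U V ->
  exists p q x u v, [/\ ((p, q), x) \in X, (p, u) \in U, (q, v) \in V &
    t = ((catrev x u, catrev x v), u ++ v)].
Proof.
case/mapP=> r; rewrite mem_filter => /andP[/andP[/eqP e1 /eqP e2]].
case/allpairsP=> -[s [q' v]] /= [/allpairsP[[[[p q] x] [p' u]] /= [xX uU ->]]].
move=> vV rE ->; rewrite rE /= in e1 e2 *; subst p' q'.
by exists p, q, x, u, v.
Qed.

Lemma candidates_complete X U V p q x u v :
  ((p, q), x) \in X -> (p, u) \in U -> (q, v) \in V ->
  ((catrev x u, catrev x v), u ++ v) \in candidates X U V.
Proof.
move=> xX uU vV; apply/mapP; exists ((((p, q), x), (p, u)), (q, v)) => //.
rewrite mem_filter /= !eqxx /=; apply/allpairsP.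
exists ((((p, q), x), (p, u)), (q, v)); split=> //.
by apply/allpairsP; exists (((p, q), x), (p, u)).
Qed.

(** * Cancellation in quotients of words *)

Lemma size_reduce (w : word) : size (reduce w) <= size w.
Proof.
elim: w => //= x w; rewrite -/(reduce w).
by case: (reduce w) => //= y v; case: ifP => _ /=; lia.
Qed.

Lemma winv_cat (u v : word) : winv (u ++ v) = winv v ++ winv u.
Proof. by rewrite /winv map_cat rev_cat. Qed.

Lemma size_winv (w : word) : size (winv w) = size w.
Proof. by rewrite size_rev size_map. Qed.

Lemma reduce_cancel (u w v : word) :
  reduce w = [::] -> reduce (u ++ w ++ v) = reduce (u ++ v).
Proof. by move=> w0; rewrite -reduce_catr -(reduce_catl w) w0 reduce_catr. Qed.

(** Insert [u ++ winv u] before [v]; this [u] may be replaced by [reduce u], which cancels against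
    [winv (reduce u)]. *)
Lemma reduce_quotient_reduced (u v : word) :
  reduce (winv (reduce u) ++ reduce v) = reduce (winv u ++ v).
Proof.
rewrite reduce_catr -(reduce_cancel _ _ (reduce_winvr u)) -catA.
rewrite -reduce_catr -(reduce_catl u) reduce_catr.
by rewrite catA -reduce_catl reduce_winvl.
Qed.

Lemma reduce_quotient_prefix (w u v : word) :
  reduce (winv (w ++ u) ++ w ++ v) = reduce (winv u ++ v).
Proof.
by rewrite winv_cat -catA (catA _ w) reduce_cancel // reduce_winvl.
Qed.

Lemma reduced_winv (w : word) : reduced w -> reduced (winv w).
Proof.
rewrite /reduced /winv rev_sorted sorted_map; apply: sub_sorted => x y /=.
by rewrite linvK eq_sym.
Qed.

Lemma reduced_cat_cons (u v : word) x y :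
  reduced (rcons u x) -> reduced (y :: v) -> y != linv x ->
  reduced (rcons u x ++ y :: v).
Proof.
rewrite /reduced => ru rv xy; case: u ru => [|z u] /=; first by rewrite xy.
by rewrite cat_path last_rcons => -> /=; rewrite xy.
Qed.

(* Once the longest common prefix is removed nothing cancels. *)
Lemma common_prefix_split (g h : word) : reduced g -> reduced h ->
  exists p u v, [/\ g = p ++ u, h = p ++ v
                  & size (reduce (winv g ++ h)) = size u + size v].
Proof.
elim: g h => [|x g IH] h rg rh.
  by exists [::], [::], h; rewrite /winv /= reduce_id.
case: h rh => [|y h] rh.
  exists [::], (x :: g), [::]; split=> //; rewrite cats0 addn0.
  by rewrite reduce_id ?size_winv // reduced_winv.
have [xy|xy] := eqVneq x y; last first.
  exists [::], (x :: g), (y :: h); split=> //.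
  rewrite reduce_id ?size_cat ?size_winv //.
  have := reduced_winv rg; rewrite {1 2}/winv /= rev_cons => rxg.
  by apply: reduced_cat_cons => //; rewrite linvK eq_sym.
rewrite -xy in rh *; move: rg rh; rewrite !reduced_cons.
move=> /andP[_ rg] /andP[_ rh].
have [p [u [v [-> -> E]]]] := IH h rg rh.
exists (x :: p), u, v; split=> //.
by rewrite -!cat_cons !reduce_quotient_prefix in E *.
Qed.

Definition recognizes (M : nfa) (g : word) : Prop :=
  exists i f w, [/\ i \in M.2.1, f \in M.2.2.1, reads M.2.2.2 i w f
                  & reduce w = g].

Section Saturated.
Variable M : nfa.
Let V := used_states M.2.1 M.2.2.1 M.2.2.2.

Lemma used_edge p o q : (p, (o, q)) \in M.2.2.2 -> p \in V /\ q \in V.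
Proof.
move=> eE; rewrite !mem_cat.
rewrite (map_f (fun e : edge => e.1) eE).
by rewrite (map_f (fun e : edge => e.2.2) eE) !orbT.
Qed.

Lemma used_initial i : i \in M.2.1 -> i \in V.
Proof. by move=> iM; rewrite mem_cat iM. Qed.

Lemma saturated_refl p o q :
  (p, (o, q)) \in saturated M -> (q, (None, q)) \in saturated M.
Proof.
by case/(saturate_states (@used_edge)) => _; apply: saturate_refl.
Qed.

Lemma saturated_initial i : i \in M.2.1 -> (i, (None, i)) \in saturated M.
Proof. by move/used_initial; apply: saturate_refl. Qed.

Lemma recognizes_saturated g : recognizes M g ->
  exists i f, [/\ i \in M.2.1, f \in M.2.2.1 & reads (saturated M) i g f].
Proof.
case=> i [f [w [iM fM if_ <-]]]; exists i, f; split=> //.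
exact: (saturate_complete (@used_edge)) if_ (used_initial iM).
Qed.

Lemma saturated_recognizes i f w : i \in M.2.1 -> f \in M.2.2.1 ->
  reads (saturated M) i w f -> recognizes M (reduce w).
Proof.
by move=> iM fM /saturate_sound[w' w'P <-]; exists i, f, w'.
Qed.

Lemma recognizes_reduced g : recognizes M g -> reduced g.
Proof. by case=> i [f [w [_ _ _ <-]]]; apply: reduce_reduced. Qed.

End Saturated.

Lemma solve_correct (M N : nfa) :
  (exists g, recognizes M g) -> (exists h, recognizes N h) ->
  let: (r, s) := solve M N in
  [/\ recognizes M r, recognizes N s &
    forall g h, recognizes M g -> recognizes N h ->
      size (reduce (winv r ++ s)) <= size (reduce (winv g ++ h))].
Proof.
move=> [g0 g0M] [h0 h0N].
(* Used twice: for [g0] and [h0] it shows that there is a solution, and for arbitrary [g] and [h]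
   that this solution is minimal. *)
have minP g h : recognizes M g -> recognizes N h ->
    exists2 t, solution_words M N = Some t
             & size t.2 <= size (reduce (winv g ++ h)).
  move=> gM hN.
  have [i [f [iM fM if_]]] := recognizes_saturated gM.
  have [j [e [jN eN je]]] := recognizes_saturated hN.
  have [p [u [v [gE hE ->]]]] :=
    common_prefix_split (recognizes_reduced gM) (recognizes_reduced hN).
  rewrite gE in if_; rewrite hE in je.
  have [a ia af] := reads_split if_; have [b jb be] := reads_split je.
  have [x xX] := common_prefixes_complete (@saturated_refl M)
    (@saturated_refl N) iM jN (saturated_initial iM) (saturated_initial jN)
    ia jb.
  have [u' uU u'u] := shortest_suffixes_min fM af.
  have [v' vV v'v] := shortest_suffixes_min eN be.
  have [t tE ts] := shortest_min (candidates_complete xX uU vV).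
  by exists t => //; rewrite (leq_trans ts) // size_cat leq_add.
have [t tE _] := minP _ _ g0M h0N; rewrite /solve tE.
have [a [b [x [u [v [xX uU vV tuv]]]]]] := candidates_sound (shortest_mem tE).
have [i [j [iM jN ia jb]]] := common_prefixes_sound xX.
have [f fM af] := shortest_suffixes_sound uU.
have [e eN be] := shortest_suffixes_sound vV.
rewrite tuv /= !catrevE; split.
- exact: saturated_recognizes iM fM (reads_cat ia af).
- exact: saturated_recognizes jN eN (reads_cat jb be).
move=> g h gM hN; have [t' t'E] := minP _ _ gM hN.
move: t'E; rewrite tE tuv => -[<-] /=; apply: leq_trans.
(* The common prefix drops out. The suffixes [u] and [v] may cancel further, so their lengths bound
   the distance only from above, which is the direction required. *)
rewrite reduce_quotient_reduced reduce_quotient_prefix.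
by apply: leq_trans (size_reduce _) _; rewrite !size_cat size_winv.
Qed.

(** * Encoding of the automata *)

Definition nfa_of (M : automaton A) : nfa :=
  (nstates M,
    ([seq val p | p <- enum (initial M)],
      ([seq val p | p <- enum (final M)],
        [seq (val e.1.1, (e.1.2, val e.2)) | e <- enum (edges M)]))).

(** Transfers the running time of [solve] on tuples to the prescribed encoding of automata. *)
Lemma encode_nfa_of (M : automaton A) : encode (nfa_of M) = enc_automaton M.
Proof.
have sE n (s : seq 'I_n) :
    encode [seq val p | p <- s] = enc_seq (@enc_state n) s.
  by rewrite /encode /=; elim: s => //= p s ->.
rewrite /enc_automaton -!sE; congr (Node _ (Node _ (Node _ _))).
by rewrite /encode /=; elim: (enum _) => //= e s ->.
Qed.

Lemma mem_edges_nfa_of (M : automaton A) (p q : 'I_(nstates M)) o :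
  ((val p, (o, val q)) \in (nfa_of M).2.2.2) = ((p, o, q) \in edges M).
Proof.
apply/mapP/idP => [[[[a o'] b]]|eM].
  by rewrite mem_enum => eM [/val_inj-> -> /val_inj->].
by exists (p, o, q); rewrite ?mem_enum.
Qed.

Lemma run_reads (M : automaton A) (p q : 'I_(nstates M)) w :
  run p w q -> reads (nfa_of M).2.2.2 (val p) w (val q).
Proof.
elim=> {p w q} [p|p q r w eM _ IH|p q r x w eM _ IH]; first exact: reads_nil.
- by apply: (reads_step (o := None)) IH; rewrite mem_edges_nfa_of.
- by apply: (reads_step (o := Some x)) IH; rewrite mem_edges_nfa_of.
Qed.

Lemma reads_run (M : automaton A) (p q : 'I_(nstates M)) w :
  reads (nfa_of M).2.2.2 (val p) w (val q) -> run p w q.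
Proof.
move pE: (val p) => p'; move qE: (val q) => q' H.
elim: H p pE qE => {p' w q'} [r|r o s w q' eM _ IH] p pE qE.
  by rewrite -qE in pE; rewrite (val_inj pE); constructor.
(* [reads] passes through arbitrary numbers; the edge list shows that the intermediate one is the
   value of a state [b]. *)
have [[[a o'] b] _ [_ _ sb]] := mapP eM; rewrite sb in eM IH.
rewrite -pE mem_edges_nfa_of in eM; have {}IH := IH b erefl qE.
by case: o eM => [x|] eM; [apply: run_letter eM IH|apply: run_eps eM IH].
Qed.

Lemma recognizes_nfa_of (M : automaton A) (f : free_group A) :
  rational_subset M f <-> recognizes (nfa_of M) (free_word f).
Proof.
split=> [[w [p [q [pM qM pq]]] <-]|[i [j [w [/mapP[p pM ->] /mapP[q qM ->]]]]]].
  exists (val p), (val q), w; split; rewrite ?map_f ?mem_enum ?word_eltE //.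
  exact: run_reads.
rewrite !mem_enum in pM qM; move=> /reads_run pq wE; exists w.
  by exists p, q.
by apply: val_inj; rewrite /= word_eltE.
Qed.

(** * Size of the encoded input, the basis being fixed *)

Lemma csize_letter (x : letter A) : csize x <= 2 * #|A| + 4.
Proof.
case: x => a b; have bB : csize b <= 3 by case: b.
apply: (leq_trans (n := (csize (nat_of_ord (enum_rank a)) + csize b).+1)) => //.
have arith k j n : k < n -> j <= 3 -> (k.*2.+1 + j).+1 <= 2 * n + 4 by lia.
by rewrite csize_nat; apply: arith (ltn_ord _) bB.
Qed.

Lemma csize_ord n (p : 'I_n) : csize (val p) <= 2 * n.
Proof. by rewrite csize_nat -mul2n ltn_pmul2l // ltn_ord. Qed.

Lemma csize_states n (s : seq 'I_n) :
  csize [seq val p | p <- s] <= 1 + size s * (2 * n + 1).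
Proof.
rewrite -(size_map val s); apply: csize_seq_le => _ /mapP[p _ ->].
exact: csize_ord.
Qed.

Lemma csize_edges (M : automaton A) :
  csize (nfa_of M).2.2.2 <=
    1 + #|edges M| * (4 * nstates M + 2 * #|A| + 11).
Proof.
rewrite cardE -(size_map (fun e => (val e.1.1, (e.1.2, val e.2)))).
have -> : 4 * nstates M + 2 * #|A| + 11 = 4 * nstates M + 2 * #|A| + 10 + 1.
  by rewrite -!addnA.
apply: csize_seq_le => _ /mapP[[[p o] q] _ ->].
have oB : csize o <= 2 * #|A| + 6.
  case: o => [x|]; last by rewrite addnS.
  apply: leq_trans (leq_add (leqnn 2) (csize_letter x)) _.
  by rewrite addnC -addnA.
have arith i j k n l : i <= 2 * n -> j <= l + 6 -> k <= 2 * n ->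
  (i + (j + k).+1).+1 <= 4 * n + l + 10 by lia.
exact: arith (csize_ord p) oB (csize_ord q).
Qed.

(** States are written in unary, so each edge takes linear space and the whole code is quadratic in
    the size of the automaton. *)
Lemma csize_nfa_of (M : automaton A) :
  csize (nfa_of M) <= (2 * #|A| + 40) * (automaton_size M).+1 ^ 2.
Proof.
have eB := csize_edges M.
have iB := csize_states (enum (initial M)).
have fB := csize_states (enum (final M)).
have iS : size (enum (initial M)) <= nstates M.
  by rewrite -cardE -[leqRHS]card_ord max_card.
have fS : size (enum (final M)) <= nstates M.
  by rewrite -cardE -[leqRHS]card_ord max_card.
move: eB iB fB; rewrite !csize_pair csize_nat /automaton_size.
have arith n e a x y z s t : x <= 1 + e * (4 * n + 2 * a + 11) ->
    y <= 1 + s * (2 * n + 1) -> z <= 1 + t * (2 * n + 1) ->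
    s <= n -> t <= n ->
    (n.*2.+1 + (y + (z + x).+1).+1).+1 <= (2 * a + 40) * (n + e).+1 ^ 2.
  (* [T] dominates [n], [e] and 1, so every term is at most a multiple of [T * T], with a
     coefficient depending only on [a]. *)
  move=> xB yB zB sn tn; set T := (n + e).+1.
  have eT : e * (4 * n + 2 * a + 11) <= T * ((2 * a + 15) * T).
    by apply: leq_mul; rewrite /T; nia.
  have sT : s * (2 * n + 1) <= T * (3 * T) by apply: leq_mul; rewrite /T; lia.
  have tT : t * (2 * n + 1) <= T * (3 * T) by apply: leq_mul; rewrite /T; lia.
  have nT : n * 1 <= T * T by apply: leq_mul; rewrite /T; lia.
  have T1 : 1 * 1 <= T * T by apply: leq_mul; rewrite /T; lia.
  rewrite mulnCA in eT; rewrite !(mulnCA T) in sT tT.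
  by rewrite expnS expn1 mulnDl; move: (T * T) eT sT tT nT T1 => Q; nia.
by move=> xB yB zB; exact: arith xB yB zB iS fS.
Qed.

Lemma word_distE (f g : free_group A) :
  word_dist f g = size (reduce (winv (free_word f) ++ free_word g)).
Proof. by rewrite /word_dist /free_norm /= reduce_catl. Qed.

Lemma solve_computable : exists prog k d, forall M N : automaton A,
  0 < automaton_size M -> exists t,
    computes prog (Node (enc_automaton M) (enc_automaton N))
      (Node (enc_seq (@enc_letter A) (solve (nfa_of M) (nfa_of N)).1)
            (enc_seq (@enc_letter A) (solve (nfa_of M) (nfa_of N)).2)) t
    /\ t <= k * (automaton_size M + automaton_size N) ^ d + k.
Proof.
have [c [K cP]] := ptimeP 0 ptime_solve.
pose C := 2 * #|A| + 40.
(* For sizes [m > 0] and [n], both [m.+1] and [n.+1] are at most [2 * (m + n)]. The two codes then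
   contribute [8 * C * (m + n) ^ 2], and the node joining them is absorbed by raising 8 to 9. *)
exists c, (K * (9 * C) ^ K), (2 * K) => M N M0.
have inE : input_store (Node (enc_automaton M) (enc_automaton N)) 0
    = encode (nfa_of M, nfa_of N).
  by rewrite -(encode_nfa_of M) -(encode_nfa_of N).
have [s' [t [e r0 _ tK]]] := cP _ _ inE.
exists t; split; first by exists s'.
apply: leq_trans tK (leq_trans _ (leq_addr _ _)).
rewrite -mulnA expnM -expnMn; apply: leq_poly.
have MB : csize (nfa_of M) <= C * (automaton_size M).+1 ^ 2 := csize_nfa_of M.
have NB : csize (nfa_of N) <= C * (automaton_size N).+1 ^ 2 := csize_nfa_of N.
rewrite csize_pair; move: MB NB M0.
have C0 : 0 < C by rewrite addn_gt0 orbT.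
move: (automaton_size M) (automaton_size N) => m n MB NB m0.
have mB : C * m.+1 ^ 2 <= C * (4 * (m + n) ^ 2).
  by rewrite leq_mul2l -(expnMn 2 _ 2) leq_exp2r //; apply/orP; right; lia.
have nB : C * n.+1 ^ 2 <= C * (4 * (m + n) ^ 2).
  by rewrite leq_mul2l -(expnMn 2 _ 2) leq_exp2r //; apply/orP; right; lia.
have CB : 1 <= C * (m + n) ^ 2 by rewrite muln_gt0 C0 expn_gt0 addn_gt0 m0.
apply: leq_ltn_trans (leq_add (leq_trans MB mB) (leq_trans NB nB)) _.
by rewrite -!mulnA; move: (_ ^ 2) CB => Q CB; nia.
Qed.

End Algorithm.

Theorem theorem4p2 (A : finType) :
  exists (prog : cmd) (k d : nat),
  forall M N : automaton A,
    deterministic M -> deterministic N ->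
    (exists f, rational_subset M f) -> (exists f, rational_subset N f) ->
    exists (r s : free_group A) (t : nat),
      [/\ computes prog (Node (enc_automaton M) (enc_automaton N))
                   (Node (enc_free r) (enc_free s)) t,
          (t <= k * (automaton_size M + automaton_size N) ^ d + k)%N,
          rational_subset M r,
          rational_subset N s
        & forall r' s' : free_group A,
            rational_subset M r' -> rational_subset N s' ->
            (word_dist r s <= word_dist r' s')%N].
Proof.
have [c [k [d cP]]] := solve_computable A.
exists c, k, d => M N _ _ [f0 f0M] [g0 g0N].
(* A nonempty rational subset forces an initial state to exist. *)
have M0 : 0 < automaton_size M.
  have [w [p _] _] := f0M.
  by rewrite /automaton_size addn_gt0 (leq_ltn_trans _ (ltn_ord p)).
have gM : exists g, recognizes (nfa_of M) g.
  by exists (free_word f0); apply/recognizes_nfa_of.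
have hN : exists g, recognizes (nfa_of N) g.
  by exists (free_word g0); apply/recognizes_nfa_of.
have := solve_correct gM hN; have [t] := cP M N M0.
case: (solve _ _) => r s [rst tB] [rM sN rs_min].
(* The words returned are already reduced, so passing to group elements leaves the output tree
   unchanged. *)
have rE : free_word (free_of_word r) = r.
  exact: reduce_id (recognizes_reduced rM).
have sE : free_word (free_of_word s) = s.
  exact: reduce_id (recognizes_reduced sN).
exists (free_of_word r), (free_of_word s), t; split=> //.
- by rewrite /enc_free rE sE.
- by apply/recognizes_nfa_of; rewrite rE.
- by apply/recognizes_nfa_of; rewrite sE.
move=> f g /recognizes_nfa_of fM /recognizes_nfa_of gN.
by rewrite !word_distE rE sE; apply: rs_min.
Qed.
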